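(* Let $(X,T)$ be a topological dynamical system and let $(\mathscr M(X),T_* )$ be the induced system on the space of Borel probability measures. Let $\mathrm{scl}=\{\mathrm{scl}_\alpha\}_{\alpha\ge0}$ be a scaling, put $a_\alpha(n)=-\log\mathrm{scl}_\alpha(e^{-n})$, and let $$\mathcal B_{\log}=\Bigl\{\alpha>0:\ \text{there is no }\beta\in(0,\alpha)\text{ with }\lim_{n\to\infty}\frac{a_\beta(n)\log(n+1)}{a_\alpha(n)}=0\Bigr\}.$$ Suppose that either $\mathcal B_{\log}=\emptyset$, or $\mathcal B_{\log}\ne\emptyset$ and $$\inf_{\gamma>0}\limsup_{n\to\infty}\frac{a_\gamma(n)}{n}=0,\qquad \liminf_{n\to\infty}\frac{a_\alpha(n)}{n}>0\ \text{ for every }\alpha\in\mathcal B_{\log}.$$ Then $$\overline h^{C}_{\mathrm{scl}}(T,X)=0\iff\overline h^{C}_{\mathrm{scl}}(T_*,\mathscr M(X))=0.$$ Equivalently, $\overline h^{C}_{\mathrm{scl}}(T,X)>0\iff\overline h^{C}_{\mathrm{scl}}(T_*,\mathscr M(X))>0$.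
   Context: A topological dynamical system $(X,T)$ consists of a compact metric space $(X,d)$ and a continuous map $T:X\to X$. $\mathscr M(X)$ is the space of Borel probability measures on $X$ with the weak-$*$ topology (compact metrizable), and $T_*\mu=\mu\circ T^{-1}$; $(\mathscr M(X),T_* )$ is regarded as a topological dynamical system with any compatible metric (the quantities below do not depend on the choice). A scaling is a family $\mathrm{scl}=(\mathrm{scl}_\alpha)_{\alpha\ge0}$ of positive non-decreasing functions on $(0,1)$ such that for all $\alpha>\beta>0$ and every $\lambda>1$ sufficiently close to $1$, $\mathrm{scl}_\alpha(\epsilon)=o(\mathrm{scl}_\beta(\epsilon^\lambda))$ and $\mathrm{scl}_\alpha(\epsilon)=o(\mathrm{scl}_\beta(\epsilon)^\lambda)$ as $\epsilon\to0^+$. Standing assumption: $\lim_{\epsilon\to0}\mathrm{scl}_\alpha(\epsilon)=0$ for every $\alpha>0$. Upper capacity entropy scale: with $d_n(x,y)=\max_{0\le j<n}d(T^jx,T^jy)$, let $s_n(X,\epsilon)$ be the maximal cardinality of a set $F\subset X$ with $d_n(x,y)\ge\epsilon$ for all distinct $x,y\in F$; $\overline\Lambda_{\mathrm{scl}_\alpha}(T,X)=\lim_{\epsilon\to0}\limsup_{n\to\infty}s_n(X,\epsilon)\,\mathrm{scl}_\alpha(e^{-n})$; $\overline h^C_{\mathrm{scl}}(T,X)=\inf\{\alpha>0:\overline\Lambda_{\mathrm{scl}_\alpha}(T,X)=0\}=\sup\{\alpha>0:\overline\Lambda_{\mathrm{scl}_\alpha}(T,X)=\infty\}$ (the two agree;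 $\sup\emptyset=0$, $\inf\emptyset=+\infty$). The same definition applies to $(\mathscr M(X),T_* )$. *)

(* Defs.v *)
From HB Require Import structures.
From mathcomp Require Import all_boot all_order all_algebra.
From mathcomp Require Import all_classical all_reals all_analysis.

Set Implicit Arguments.
Unset Strict Implicit.
Unset Printing Implicit Defensive.

Import Order.TTheory GRing.Theory Num.Theory.
Import numFieldNormedType.Exports.

Local Open Scope classical_set_scope.
Local Open Scope ring_scope.

(* Measurable types are pointed, so the metric space carrying Borel
   probability measures has to be pointed, i.e., nonempty. *)
#[short(type="pmetricType")]
HB.structure Definition PointedMetric (R : numDomainType) :=
  {T of PseudoPointedMetric R T & Metric R T}.

Record scaling (R : realType) (scl : R -> R -> R) : Prop := {
  scaling_gt0 : forall a e : R, 0 <= a -> 0 < e < 1 -> 0 < scl a e ;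
  scaling_le : forall a : R, 0 <= a ->
    {in `]0, 1[ &, {homo scl a : e1 e2 / e1 <= e2}} ;
  scaling_o_arg : forall a b : R, 0 < b < a -> \forall l \near 1^'+,
    (fun e : R => scl a e) =o_ (0^'+) (fun e : R => scl b (e `^ l)) ;
  scaling_o_val : forall a b : R, 0 < b < a -> \forall l \near 1^'+,
    (fun e : R => scl a e) =o_ (0^'+) (fun e : R => scl b e `^ l)
}.

Definition vanishing_scaling (R : realType) (scl : R -> R -> R) : Prop :=
  forall a : R, 0 < a -> scl a e @[e --> 0^'+] --> (0 : R).

Definition log_scl (R : realType) (scl : R -> R -> R) (a : R) (n : nat) : R :=
  - ln (scl a (expR (- n%:R))).

Definition B_log (R : realType) (scl : R -> R -> R) : set R :=
  [set a | 0 < a /\ ~ exists b : R, 0 < b < a /\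
    log_scl scl b n * ln n.+1%:R / log_scl scl a n @[n --> \oo] --> (0 : R)].

Section capacity_entropy.
Context (R : realType) (X : choiceType) (d : X -> X -> R) (T : X -> X).
Local Open Scope ereal_scope.

Definition dyn_dist (n : nat) (x y : X) : R :=
  \big[Num.max/0%R]_(j < n) d (iter j T x) (iter j T y).

Definition dyn_separated (n : nat) (e : R) (F : set X) : Prop :=
  forall x y, F x -> F y -> x <> y -> (e <= dyn_dist n x y)%R.

(* In \bar R, so that no bound on the size of the separated sets (a consequence
   of compactness) is needed for the definition to make sense. *)
Definition sep_number (n : nat) (e : R) : \bar R :=
  ereal_sup [set counting F | F in dyn_separated n e].

Definition upper_Lambda (s : R -> R) : \bar R :=
  lim (limn_esup (fun n => sep_number n e * (s (expR (- n%:R)))%:E)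
       @[e --> 0^'+]).

(* The limit in upper_Lambda exists, by monotonicity in e.  Under [scaling] the
   infimum below is also the supremum of the a > 0 with upper_Lambda = +oo;
   ereal_inf set0 = +oo. *)
Definition upper_capacity_entropy (scl : R -> R -> R) : \bar R :=
  ereal_inf [set a%:E | a in [set a : R | (0 < a)%R /\
                                          upper_Lambda (scl a) = 0]].

End capacity_entropy.

Section borel_probability.
Context (R : realType) (X : pmetricType R).

Definition borel := g_sigma_algebraType (@open X).

Definition borel_prob := probability borel R.

Definition integrals (mu : borel_prob) : {ptws continuousType X R -> R} :=
  fun f => \int[mu]_x f x.

(* The coarsest topology making mu |-> \int[mu]_x f x continuous for every
   continuous f : X -> R. *)
Definition weak_star : topologicalType := initial_topology integrals.

Definition is_metric (M : Type) (d : M -> M -> R) : Prop :=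
  [/\ forall x, d x x = 0,
      forall x y, d x y = 0 -> x = y,
      forall x y, d x y = d y x &
      forall x y z, d x z <= d x y + d y z].

Definition weak_star_metric (dM : borel_prob -> borel_prob -> R) : Prop :=
  is_metric dM /\
  forall U : set weak_star, open U <->
    forall mu, U mu ->
      exists2 e : R, 0 < e & [set nu | dM mu nu < e] `<=` U.

Context (T : continuousType X X).

Definition borel_map : borel -> borel := T.

Lemma measurable_borel_map : measurable_fun [set: borel] borel_map.
Proof.
apply: (measurability (@open X : set (set borel))) => //.
move=> _ [U oU <-]; rewrite setTI; apply: sub_sigma_algebra.
by apply: (@open_comp X X T) => // x _; exact: (@cts_fun X X T).
Qed.

HB.instance Definition _ := isMeasurableFun.Build _ _ _ _ borel_map
  measurable_borel_map.

Definition push_prob (mu : borel_prob) : borel_prob :=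
  distribution mu borel_map.

End borel_probability.

(* Main.v *)
(* Dirac measures embed X into its space of measures, so only the passage from X
   to the measures needs an argument.  The integrals of finitely many test
   functions against mu along an orbit of length n are approximated, at all but
   about n q^k times (q < 1), by averages over k sample points, which may be
   taken in a spanning set of X.  Recording the sample and the approximate
   integrals at the exceptional times bounds the separation numbers of the
   measures by
     s_n(X, d)^k * exp (n (2 m tau q^k + K exp (- tau)))   for all k, tau >= 0.
   If alpha is not in B_log, take k of order log n, so that the price is the
   factor log n between a_beta and a_alpha.  If alpha is in B_log, the
   hypotheses give X zero topological entropy, and a constant k suffices.
   That finitely many test functions control any compatible metric uniformly is
   the weak-star compactness of the space of measures. *)

From HB Require Import structures.
Require Import Defs.
From mathcomp Require Import all_boot all_order all_algebra.
From mathcomp Require Import finmap.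
From mathcomp Require Import all_classical all_reals all_analysis.
From mathcomp Require Import measurable_realfun ring lra.

Import Order.TTheory GRing.Theory Num.Theory.
Import numFieldNormedType.Exports.

Local Open Scope classical_set_scope.
Local Open Scope ring_scope.

Set Implicit Arguments.
Unset Strict Implicit.
Unset Printing Implicit Defensive.

(** * Integrals of continuous functions *)

Definition mean (R : realType) (X : pmetricType R) (mu : borel_prob X)
  (f : X -> R) : R := \int[mu]_x f x.

Section mean.
Context (R : realType) (X : pmetricType R).
Implicit Types (f g : X -> R) (mu : borel_prob X).

Lemma continuous_borel_measurable f : continuous f ->
  measurable_fun [set: borel X] (f : borel X -> R).
Proof.
move=> cf; apply: (measurability _ (RGenOpens.measurableE R)).
move=> _ [_ [a [b ->] <-]]; rewrite setTI; apply: sub_sigma_algebra.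
by apply: open_comp; [move=> x _; exact: cf | exact: interval_open].
Qed.

Hypothesis compactX : compact [set: X].

Lemma continuous_bounded f : continuous f ->
  exists2 M : R, 0 < M & forall x, `|f x| <= M.
Proof.
move=> cf; have /compact_bounded : compact (range f).
  by apply: continuous_compact => //; apply: continuous_subspaceT.
move=> [M [_ /(_ (Num.max M 0 + 1)) H]]; exists (Num.max M 0 + 1).
  by rewrite ltr_wpDl// le_max lexx orbT.
move=> x; apply: H; last by exists x.
by rewrite (@le_lt_trans _ _ (Num.max M 0)) ?le_max ?lexx// ltrDl.
Qed.

Lemma continuous_integrable mu f : continuous f ->
  mu.-integrable [set: borel X] (EFin \o (f : borel X -> R)).
Proof.
move=> cf; apply: measurable_bounded_integrable => //.
- by rewrite [X in (X < _)%E](_ : _ = 1%E) ?ltry//; exact: probability_setT.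
- exact: continuous_borel_measurable.
have [M M0 fM] := continuous_bounded cf; exists M; split; first by rewrite num_real.
by move=> y My x _; apply: le_trans (ltW My); exact: fM.
Qed.

Lemma mean_cst mu c : mean mu (fun=> c) = c.
Proof.
rewrite /mean Rintegral_cst//.
by rewrite [X in fine X](_ : _ = 1%E) ?mulr1//; exact: probability_setT.
Qed.

Lemma meanD mu f g : continuous f -> continuous g ->
  mean mu (fun x => f x + g x) = mean mu f + mean mu g.
Proof. by move=> cf cg; rewrite /mean RintegralD//; exact: continuous_integrable. Qed.

Lemma meanZ mu c f : continuous f -> mean mu (fun x => c * f x) = c * mean mu f.
Proof. by move=> cf; rewrite /mean RintegralZl//; exact: continuous_integrable. Qed.

Lemma mean_le mu f g : continuous f -> continuous g ->
  (forall x, f x <= g x) -> mean mu f <= mean mu g.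
Proof.
by move=> cf cg fg; rewrite /mean le_Rintegral//; exact: continuous_integrable.
Qed.

(** A continuous function on a compact space attains its minimum, which is at most its mean. This
    replaces a random choice of point in the sampling argument. *)
Lemma exists_le_mean mu f : continuous f -> exists x, f x <= mean mu f.
Proof.
move=> cf.
have [||c _ cmin] := @compact_EVT_min X R f setT _ compactX.
- by exists point.
- exact: continuous_subspaceT.
exists c; rewrite -[leLHS](mean_cst mu); apply: mean_le => //.
  by move=> x; exact: cvg_cst.
by move=> x; apply: cmin; rewrite in_setT.
Qed.

Definition dirac_prob (x : X) : borel_prob X := dirac (x : borel X).

Lemma mean_dirac x f : continuous f -> mean (dirac_prob x) f = f x.
Proof.
move=> cf; rewrite /dirac_prob /mean /Rintegral integral_dirac ?diracT ?mul1e//.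
by apply/measurable_EFinP; exact: continuous_borel_measurable.
Qed.

Lemma mean_push mu (T : continuousType X X) f : continuous f ->
  mean (push_prob T mu) f = mean mu (f \o T).
Proof.
move=> cf; rewrite /mean /Rintegral /push_prob /distribution.
have cfT : continuous (f \o T).
  by move=> x; apply: continuous_comp; [exact: cts_fun | exact: cf].
have mf : measurable_fun [set: borel X] (EFin \o (f : borel X -> R)).
  by apply/measurable_EFinP; exact: continuous_borel_measurable.
by rewrite (integral_pushforward (@measurable_borel_map _ _ T) mf)//;
  exact: continuous_integrable.
Qed.

Lemma mean_iter_push mu (T : continuousType X X) j f : continuous f ->
  mean (iter j (push_prob T) mu) f = mean mu (f \o iter j T).
Proof.
elim: j f => [//|j IH] f cf; rewrite iterS mean_push// IH//.
by move=> x; apply: continuous_comp; [exact: cts_fun | exact: cf].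
Qed.

Lemma continuous_iter (T : continuousType X X) j : continuous (iter j T).
Proof.
elim: j => [|j IH] x; first exact: cvg_id.
by apply: continuous_comp; [exact: IH | exact: cts_fun].
Qed.

End mean.

(** * Weak limits of probability measures along ultrafilters *)

(** Compactness gives a cluster point, and a cluster point of an ultrafilter is a limit, since the
    filter contains each set or its complement. *)
Lemma ultra_cvg_compact (I : Type) (U : set_system I) (Y : topologicalType)
    (K : set Y) (f : I -> Y) : UltraFilter U -> compact K ->
  (forall i, K (f i)) -> exists2 l, K l & f @ U --> l.
Proof.
move=> UU cK Kf; have [|l [Kl clf]] := cK (f @ U) _.
  by rewrite /fmap/=; apply: (@filterE _ U) => i; exact: Kf.
exists l => // A lA; have [//|UnA] := in_ultra_setVsetC (f @^-1` A) UU.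
by have [y [nAy Ay]] := clf (~` A) A UnA lA.
Qed.

Lemma le_cvg_limits (R : realFieldType) (I : Type) (F : set_system I)
    {FF : ProperFilter F} (f g : I -> R) (l l' : R) :
  f @ F --> l -> g @ F --> l' -> (forall i, f i <= g i) -> l <= l'.
Proof.
move=> fl gl fg; rewrite -subr_ge0; apply: (cvgr_to_ge (cvgB gl fl)).
by apply: filterE => i; rewrite /= subr_ge0.
Qed.

Section limit_measure.
Context (R : realType) (X : pmetricType R).
Hypothesis compactX : compact [set: X].
Context (U : set_system (borel_prob X)) {UU : UltraFilter U}.
Implicit Types (A B K L V W : set X) (mu : borel_prob X).

Let mass A (mu : borel_prob X) : R := fine (mu A).
Let mbl A := measurable (A : set (borel X)).

Let open_mbl V : open V -> mbl V.
Proof. exact: sub_sigma_algebra. Qed.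

Let closed_mbl K : closed K -> mbl K.
Proof.
move=> cK; rewrite -(setCK K); apply: (@measurableC _ (borel X)).
by apply: open_mbl; exact: closed_openC.
Qed.

Let massE A mu : mbl A -> mu A = (mass A mu)%:E.
Proof. by move=> mA; rewrite fineK// fin_num_measure. Qed.

Let mass_ge0 A mu : 0 <= mass A mu.
Proof. exact: fine_ge0. Qed.

Let mass_le1 A mu : mbl A -> mass A mu <= 1.
Proof. by move=> mA; rewrite -lee_fin -massE//; exact: probability_le1. Qed.

Let mass0 mu : mass set0 mu = 0.
Proof. by rewrite /mass measure0. Qed.

Let massT mu : mass setT mu = 1.
Proof. by rewrite /mass [X in fine X](_ : _ = 1%E)//; exact: probability_setT. Qed.

Let le_mass A B mu : mbl A -> mbl B -> A `<=` B -> mass A mu <= mass B mu.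
Proof.
by move=> mA mB AB; rewrite -lee_fin -!massE// le_measure// inE.
Qed.

Let massU A B mu : mbl A -> mbl B -> mass (A `|` B) mu <= mass A mu + mass B mu.
Proof.
move=> mA mB; rewrite -lee_fin EFinD -!massE//; last exact: measurableU.
exact: measureU2.
Qed.

Let mass_disjU A B mu : mbl A -> mbl B -> A `&` B = set0 ->
  mass (A `|` B) mu = mass A mu + mass B mu.
Proof.
move=> mA mB AB0; apply: EFin_inj.
by rewrite EFinD -!massE//; [exact: measureU | exact: measurableU].
Qed.

(** The limit exists for Borel sets by compactness of the unit interval; it is finitely additive,
    but countable additivity may be lost. *)
Let content A : R := lim (mass A mu @[mu --> U]).

Let mass_cvg A : mbl A -> mass A mu @[mu --> U] --> content A.
Proof.
move=> mA; have [|l _ lA] :=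
  @ultra_cvg_compact _ U R `[0, 1]%classic (mass A) UU (@segment_compact _ _ _).
  by move=> mu; rewrite /= in_itv/= mass_ge0 mass_le1.
by apply/cvg_ex; exists l.
Qed.

Let content0 : content set0 = 0.
Proof.
by apply/cvg_lim => //; rewrite (funext mass0); exact: cvg_cst.
Qed.

Let contentT : content setT = 1.
Proof.
by apply/cvg_lim => //; rewrite (funext massT); exact: cvg_cst.
Qed.

Let le_content A B : mbl A -> mbl B -> A `<=` B -> content A <= content B.
Proof.
move=> mA mB AB; apply: (le_cvg_limits (mass_cvg mA) (mass_cvg mB)) => mu.
exact: le_mass.
Qed.

Let contentU A B : mbl A -> mbl B -> content (A `|` B) <= content A + content B.
Proof.
move=> mA mB; have mAB := measurableU _ _ mA mB.
apply: (le_cvg_limits (mass_cvg mAB) (cvgD (mass_cvg mA) (mass_cvg mB))) => mu.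
exact: massU.
Qed.

Let content_disjU A B : mbl A -> mbl B -> A `&` B = set0 ->
  content (A `|` B) = content A + content B.
Proof.
move=> mA mB AB0; apply/cvg_lim => //.
rewrite (funext (fun mu => mass_disjU mu mA mB AB0)).
by apply: cvgD; exact: mass_cvg.
Qed.

Local Open Scope ereal_scope.

(* Regularizing from inside by closed sets makes the finitely additive limit
   content countably subadditive on open sets, by compactness. *)
Let premeasure V : \bar R :=
  ereal_sup [set (content K)%:E | K in [set K | closed K /\ K `<=` V]].

Let content_le_premeasure K V : closed K -> K `<=` V ->
  (content K)%:E <= premeasure V.
Proof. by move=> cK KV; apply: ereal_sup_ubound; exists K. Qed.

Let premeasure_le V (x : \bar R) :
  (forall K, closed K -> K `<=` V -> (content K)%:E <= x) -> premeasure V <= x.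
Proof. by move=> H; apply: ge_ereal_sup => _ [K [cK KV] <-]; exact: H. Qed.

Let premeasure_ge0 V : 0 <= premeasure V.
Proof.
rewrite -[leLHS]/(0%R%:E) -content0; apply: content_le_premeasure => //.
exact: closed0.
Qed.

Let premeasure_le_content V : open V -> premeasure V <= (content V)%:E.
Proof.
move=> oV; apply: premeasure_le => K cK KV; rewrite lee_fin.
by apply: le_content => //; [exact: closed_mbl | exact: open_mbl].
Qed.

Let premeasure_fin_num V : open V -> premeasure V \is a fin_num.
Proof.
move=> oV; rewrite ge0_fin_numE// (le_lt_trans (premeasure_le_content oV))//.
exact: ltry.
Qed.

Let le_premeasure V W : V `<=` W -> premeasure V <= premeasure W.
Proof.
move=> VW; apply: premeasure_le => K cK KV.
by apply: content_le_premeasure => //; exact: subset_trans VW.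
Qed.

Let premeasure0 : premeasure set0 = 0.
Proof.
apply/eqP; rewrite eq_le premeasure_ge0 andbT.
apply: premeasure_le => K _; rewrite subset0 => ->.
by rewrite content0.
Qed.

Let premeasureT : premeasure setT = 1.
Proof.
apply/eqP; rewrite eq_le; apply/andP; split.
  by rewrite -[leRHS]/(1%R%:E) -contentT; apply: premeasure_le_content; exact: openT.
rewrite -[leLHS]/(1%R%:E) -contentT; apply: content_le_premeasure => //.
Qed.

(** By normality, a closed set inside the union splits into a closed piece in [V] and a closed piece
    in [W]. *)
Let premeasureU2 V W : open V -> open W ->
  premeasure (V `|` W) <= premeasure V + premeasure W.
Proof.
move=> oV oW; apply: premeasure_le => K cK KVW.
have cKV : closed (K `\` V) by apply: closedI => //; exact: open_closedC.
have cKW : closed (K `\` W) by apply: closedI => //; exact: open_closedC.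
(* [N] is a neighbourhood of the part of [K] outside [V], and its closure misses the part of [K]
   outside [W]. Removing its interior leaves [K1]; its closure cuts out [K2]. *)
have [|N sN clN] := @compact_normal X (@metric_hausdorff R X) compactX
    (K `\` V) cKV (~` (K `\` W)).
  move=> x [Kx nVx]; apply: open_nbhs_nbhs; split; first exact: closed_openC.
  by move=> [_ nWx]; have [] := KVW _ Kx.
pose K1 := K `\` N°; pose K2 := K `&` closure N.
have cK1 : closed K1 by apply: closedI => //; apply: open_closedC; exact: open_interior.
have cK2 : closed K2 by apply: closedI => //; exact: closed_closure.
have KE : K `<=` K1 `|` K2.
  move=> x Kx; have [Nx|nNx] := pselect (N° x); [right|left] => //.
  by split => //; apply: subset_closure; exact: interior_subset.
have K1V : K1 `<=` V.
  move=> x [Kx nNx]; apply: contrapT => nVx; apply: nNx.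
  by apply: sN.
have K2W : K2 `<=` W.
  move=> x [Kx Nx]; apply: contrapT => nWx.
  by have := clN x Nx; apply.
apply: le_trans (leeD (content_le_premeasure cK1 K1V) (content_le_premeasure cK2 K2W)).
rewrite -EFinD lee_fin (le_trans _ (contentU (closed_mbl cK1) (closed_mbl cK2)))//.
apply: le_content => //; first exact: closed_mbl.
by apply: measurableU; exact: closed_mbl.
Qed.

Let premeasure_bigsetU (V : (set X)^nat) n : (forall i, open (V i)) ->
  premeasure (\big[setU/set0]_(i < n) V i) <= \sum_(i < n) premeasure (V i).
Proof.
move=> oV; elim: n => [|n IH]; first by rewrite !big_ord0 premeasure0.
rewrite !big_ord_recr/= (le_trans (premeasureU2 _ _))//; last exact: leeD2r.
by rewrite -bigcup_mkord; exact: bigcup_open.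
Qed.

Let premeasure_bigcup (V : (set X)^nat) : (forall i, open (V i)) ->
  premeasure (\bigcup_i V i) <= \sum_(i <oo) premeasure (V i).
Proof.
move=> oV; apply: premeasure_le => K cK KV.
have /compact_near_coveringP ncK : compact K.
  by apply: (subclosed_compact cK compactX).
have /filter_ex[n Kn] : \forall n \near \oo, K `<=` \bigcup_(i < n) V i.
  apply: ncK => x /KV[i _ Vix]; exists (V i, [set n | (i < n)%N]).
    split; last by exists i.+1.
    by apply: open_nbhs_nbhs; split; [exact: oV|].
  by move=> [y n]/= [Viy ltin]; exists i.
rewrite bigcup_mkord in Kn.
apply: le_trans (content_le_premeasure cK Kn) _.
apply: (le_trans (premeasure_bigsetU _ oV)).
rewrite -(big_mkord xpredT (fun i => premeasure (V i))).
exact: nneseries_lim_ge.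
Qed.

(** Outer regularization by open sets, as in the Riesz representation theorem; its restriction to
    Borel sets is the limit measure. *)
Let outer A : \bar R :=
  ereal_inf [set premeasure V | V in [set V | open V /\ A `<=` V]].

Let outer_le_premeasure A V : open V -> A `<=` V -> outer A <= premeasure V.
Proof. by move=> oV AV; apply: ereal_inf_lbound; exists V. Qed.

Let le_outer A (x : \bar R) :
  (forall V, open V -> A `<=` V -> x <= premeasure V) -> x <= outer A.
Proof. by move=> H; apply: le_ereal_inf_tmp => _ [V [oV AV] <-]; exact: H. Qed.

Let outer_open V : open V -> outer V = premeasure V.
Proof.
move=> oV; apply/eqP; rewrite eq_le outer_le_premeasure//=.
by apply: le_outer => W oW VW; exact: le_premeasure.
Qed.

Let outer_ge0 A : 0 <= outer A.
Proof. by apply: le_outer. Qed.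

Let outer_fin_num A : outer A \is a fin_num.
Proof.
rewrite ge0_fin_numE// (@le_lt_trans _ _ 1) ?ltry// -premeasureT.
by apply: outer_le_premeasure => //; exact: openT.
Qed.

Let outer0 : outer set0 = 0.
Proof. by rewrite outer_open ?premeasure0//; exact: open0. Qed.

Let le_outer_sub : {homo outer : A B / A `<=` B >-> A <= B}.
Proof.
move=> A B AB; apply: le_outer => V oV BV; apply: outer_le_premeasure => //.
exact: subset_trans BV.
Qed.

Let outer_sigma_subadditive : sigma_subadditive outer.
Proof.
move=> F; apply/lee_addgt0Pr => e e0.
have /choice[V VP] : forall i, exists V, [/\ open V, F i `<=` V &
    premeasure V <= outer (F i) + (e / (2 ^ i.+1)%:R)%:E].
  move=> i; have : outer (F i) < outer (F i) + (e / (2 ^ i.+1)%:R)%:E.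
    by rewrite lteDl// lte_fin divr_gt0// ltr0n expn_gt0.
  by move=> /ereal_inf_lt[_ [V [oV FV] <-] /ltW lV]; exists V.
apply: (@le_trans _ _ (premeasure (\bigcup_i V i))).
  apply: outer_le_premeasure; first by apply: bigcup_open => i _; case: (VP i).
  by apply: subset_bigcup => i _; case: (VP i).
apply: (le_trans (premeasure_bigcup _)); first by move=> i; case: (VP i).
apply: (le_trans _ (epsilon_trick _ _ (ltW e0))) => //.
by apply: lee_nneseries => // i _; case: (VP i).
Qed.

HB.instance Definition _ := isOuterMeasure.Build R X outer
  outer0 outer_ge0 le_outer_sub outer_sigma_subadditive.

(** For [W] open around [A], choose a closed [K] in the trace of [W] on [V], then a closed [L] in
    [W] minus [K]. They are disjoint, so their contents add up to at most the premeasure of [W]. *)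
Let open_caratheodory V : open V -> (outer : set X -> \bar R).-caratheodory V.
Proof.
move=> oV; apply: le_caratheodory_measurable => A.
apply: le_outer => W oW AW.
rewrite -leeBrDr//; apply: le_trans (_ : premeasure (W `&` V) <= _).
  by apply: outer_le_premeasure; [exact: openI | exact: setSI].
apply: premeasure_le => K cK KWV; rewrite leeBrDr// addeC -leeBrDr//.
apply: le_trans (_ : premeasure (W `\` K) <= _).
  apply: outer_le_premeasure; first by apply: openI => //; exact: closed_openC.
  by move=> x [Ax nVx]; split; [exact: AW | move=> /KWV[]].
apply: premeasure_le => L cL LWK; rewrite leeBrDr// -EFinD.
rewrite -content_disjU; [|exact: closed_mbl|exact: closed_mbl|].
  apply: content_le_premeasure; first exact: closedU.
  by rewrite subUset; split; [move=> x /LWK[] | move=> x /KWV[]].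
by rewrite -subset0 => x [/LWK[_ nKx] Kx].
Qed.

Let mbl_caratheodory : mbl `<=` (outer : set X -> \bar R).-caratheodory.
Proof.
move=> A mA; have : (outer : set X -> \bar R).-cara.-measurable A.
  move: A mA; apply: smallest_sub; last exact: open_caratheodory.
  exact: sigma_algebra_measurable.
by [].
Qed.

Definition limit_measure : set (borel X) -> \bar R := outer.

Let limit0 : limit_measure set0 = 0. Proof. exact: outer0. Qed.
Let limit_ge0 A : 0 <= limit_measure A. Proof. exact: outer_ge0. Qed.
Let limit_sigma_additive : semi_sigma_additive limit_measure.
Proof.
move=> F mF tF mbF.
apply: (@caratheodory_measure_sigma_additive R X outer F _ tF) => [i|].
  exact: mbl_caratheodory (mF i).
exact: mbl_caratheodory mbF.
Qed.

HB.instance Definition _ := isMeasure.Build _ _ _ limit_measure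
  limit0 limit_ge0 limit_sigma_additive.

Let limitT : limit_measure setT = 1.
Proof. by rewrite /limit_measure outer_open ?premeasureT//; exact: openT. Qed.

HB.instance Definition _ := Measure_isProbability.Build _ _ _ limit_measure limitT.

(** Portmanteau inequality for open sets. It can be strict, because mass may escape to the boundary
    of [V] in the limit. *)
Lemma exists_limit_measure : exists nu : borel_prob X, forall V, open V ->
  exists2 l : R, fine (mu V) @[mu --> U] --> l & (fine (nu V) <= l)%R.
Proof.
exists (limit_measure : borel_prob X) => V oV; exists (content V).
  by apply: mass_cvg; exact: open_mbl.
rewrite -lee_fin [X in (fine X)%:E](_ : _ = premeasure V); last exact: outer_open.
by rewrite fineK ?premeasure_fin_num// premeasure_le_content.
Qed.

End limit_measure.

(** The sum counts the naturals below both [k] and [z]: it is the smaller of [k] and the ceiling of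
    [z]. *)
Lemma count_lt_bounds (R : realDomainType) (z : R) (k : nat) : 0 <= z ->
  Num.min z k%:R <= \sum_(i < k) (i%:R < z)%R%:R <= z + 1.
Proof.
move=> z0; elim: k => [|k /andP[lek gek]].
  by rewrite big_ord0 ge_min lexx orbT/= addr_ge0.
have sk : \sum_(i < k) (i%:R < z)%R%:R <= k%:R :> R.
  rewrite -[leRHS]mulr1 mulr_natl -[k in leRHS]card_ord -sumr_const.
  by apply: ler_sum => i _; case: (_ < _).
rewrite big_ord_recr/=; have [kz|zk]/= := ltP k%:R z.
  rewrite lerD2r (le_trans sk (ltW kz)) andbT ge_min; apply/orP; right.
  by rewrite -natr1 lerD2r; move: lek; rewrite min_r ?(ltW kz).
rewrite addr0 gek andbT (le_trans _ lek)// min_l ?min_l//.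
by rewrite (le_trans zk)// ler_nat.
Qed.

(** * Layer-cake sums and weak-star compactness *)

Section layer_cake.
Context (R : realType) (X : pmetricType R).
Hypothesis compactX : compact [set: X].
Implicit Types (f : X -> R) (mu : borel_prob X).

Lemma open_superlevel f (t : R) : continuous f -> open [set x | t < f x].
Proof.
move=> cf; apply: (@open_comp _ _ f [set y | t < y]); last exact: open_gt.
by move=> x _; exact: cf.
Qed.

(** A Riemann sum of the layer-cake formula. For continuous [f] it involves [mu] only through masses
    of open sets, which [exists_limit_measure] controls. *)
Definition superlevel_average f k mu : R :=
  k%:R^-1 * \sum_(i < k) fine (mu [set x | i%:R / k%:R < f x]).

(* Layer-cake formula: [k * f x] differs by at most 1 from the number of [i < k]
   with [i / k < f x]. *)
Lemma superlevel_average_bounds f k mu : continuous f ->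
  (forall x, 0 <= f x <= 1) -> (0 < k)%N ->
  mean mu f <= superlevel_average f k mu <= mean mu f + k%:R^-1.
Proof.
move=> cf f01 k0; have k0' : (0 : R) < k%:R by rewrite ltr0n.
pose L i : set (borel X) := [set x | i%:R / k%:R < f x].
have mL i : measurable (L i) by apply: sub_sigma_algebra; exact: open_superlevel.
have iL i : mu.-integrable setT (EFin \o (\1_(L i) : borel X -> R)).
  by apply: integrable_indic.
have sumE n : mu.-integrable setT (EFin \o (fun x => \sum_(i < n) \1_(L i) x : R)) /\
    \int[mu]_x (\sum_(i < n) \1_(L i) x) = \sum_(i < n) fine (mu (L i)).
  elim: n => [|n [iS SE]].
    rewrite big_ord0 /=; split.
      under eq_fun do rewrite big_ord0; exact: integrable0.
    by under eq_Rintegral do rewrite big_ord0; exact: mean_cst.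
  split.
    rewrite (_ : EFin \o _ =
      (EFin \o (fun x : borel X => \sum_(i < n) \1_(L i) x : R)%R) \+
      (EFin \o (\1_(L n) : borel X -> R)))%E; first exact: integrableD.
    by apply/funext => x /=; rewrite big_ord_recr.
  under eq_Rintegral do rewrite big_ord_recr/=.
  rewrite RintegralD// SE big_ord_recr/=; congr (_ + _).
  by rewrite /Rintegral integral_indic// setIT.
have [iS SE] := sumE k.
pose g x := k%:R^-1 * \sum_(i < k) \1_(L i) x : R.
have ig : mu.-integrable setT (EFin \o g).
  have := @integrableZl _ _ R mu setT measurableT k%:R^-1 _ iS.
  by apply: eq_integrable => // x _ /=; rewrite EFinM.
have gE : \int[mu]_x g x = superlevel_average f k mu.
  by rewrite RintegralZl// SE.
have fg x : f x <= g x <= f x + k%:R^-1.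
  have /andP[fx0 fx1] := f01 x.
  have kf : 0 <= k%:R * f x by rewrite mulr_ge0// ltW.
  have := count_lt_bounds k kf.
  have -> : Num.min (k%:R * f x) k%:R = k%:R * f x.
    by rewrite min_l// ler_piMr// ltW.
  have -> : \sum_(i < k) (i%:R < k%:R * f x)%R%:R = k%:R * g x :> R.
    rewrite mulVKf ?gt_eqF//; apply: eq_bigr => i _; rewrite indicE.
    rewrite mulrC -ltr_pdivrMr//; congr (nat_of_bool _)%:R.
    by apply/idP/idP; rewrite inE.
  rewrite ler_pM2l// => /andP[-> /= gle].
  by rewrite -(ler_pM2l k0') mulrDr divff// gt_eqF.
rewrite -gE; apply/andP; split.
  apply: le_Rintegral => //; first exact: continuous_integrable.
  by move=> x _; case/andP: (fg x).
have ccst : continuous (fun _ : X => k%:R^-1 : R) by move=> x; exact: cvg_cst.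
rewrite -{1}(mean_cst mu k%:R^-1) -meanD//; apply: le_Rintegral => //.
  apply: continuous_integrable => // x; apply: cvgD; [exact: cf | exact: ccst].
by move=> x _; case/andP: (fg x).
Qed.

(** The inequality on open sets only shows that the mean under [nu] is at most the limit of the
    means, first for values in the unit interval, then by affine rescaling for all [f]. Applying
    this to the opposite of [f] gives equality. *)
Lemma ultra_weak_limit (U : set_system (borel_prob X)) : UltraFilter U ->
  exists nu : borel_prob X, forall f, continuous f ->
    mean mu f @[mu --> U] --> mean nu f.
Proof.
move=> UU; have [nu nuU] := exists_limit_measure compactX (U := U).
have bounded01 f : continuous f -> (forall x, 0 <= f x <= 1) ->
    forall l : R, mean mu f @[mu --> U] --> l -> mean nu f <= l.
  move=> cf f01 l fl.
  have key k : (0 < k)%N -> mean nu f <= l + k%:R^-1.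
    move=> k0.
    have /choice[t tP] : forall i : 'I_k, exists l : R,
        fine (mu [set x | i%:R / k%:R < f x]) @[mu --> U] --> l /\
        (fine (nu [set x | i%:R / k%:R < f x]) <= l)%R.
      move=> i; have [l' ? ?] := nuU _ (open_superlevel (i%:R / k%:R) cf).
      by exists l'.
    have lA : superlevel_average f k mu @[mu --> U] -->
        k%:R^-1 * \sum_(i < k) t i.
      apply: cvgMl_tmp; apply: cvg_big => // [|i _]; first exact: add_continuous.
      exact: (tP i).1.
    have lr : mean mu f + k%:R^-1 @[mu --> U] --> l + k%:R^-1.
      by apply: cvgD => //; exact: cvg_cst.
    have /andP[+ _] := superlevel_average_bounds nu cf f01 k0.
    move=> /le_trans; apply.
    apply: (@le_trans _ _ (k%:R^-1 * \sum_(i < k) t i)).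
      rewrite ler_wpM2l ?invr_ge0//; apply: ler_sum => i _; exact: (tP i).2.
    apply: (le_cvg_limits lA lr) => mu.
    by case/andP: (superlevel_average_bounds mu cf f01 k0).
  apply/ler_addgt0Pr => e e0.
  apply: le_trans (key (Num.truncn e^-1).+1 isT) _; rewrite lerD2l.
  rewrite invf_ple ?posrE// ltW//; exact: truncnS_gt.
have le_lim f : continuous f -> forall l : R,
    mean mu f @[mu --> U] --> l -> mean nu f <= l.
  move=> cf l fl; have [M M0 fM] := continuous_bounded compactX cf.
  (* With this slope [c * f] is bounded by 1/2, and a shift by 1/2 brings the values into the unit
     interval. *)
  pose c := (M *+ 2)^-1.
  have c0 : 0 < c by rewrite invr_gt0 pmulrn_lgt0.
  pose g x := c * f x + 2^-1.
  have ccst (a : R) : continuous (fun _ : X => a) by move=> x; exact: cvg_cst.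
  have ccf : continuous (fun x => c * f x).
    by move=> x; apply: cvgMl_tmp; exact: cf.
  have cg : continuous g.
    by move=> x; apply: cvgD; [exact: ccf | exact: ccst].
  have g01 x : 0 <= g x <= 1.
    have : `|c * f x| <= 2^-1.
      rewrite normrM gtr0_norm// -[leRHS](_ : c * M = _).
        by rewrite ler_pM2l.
      by rewrite /c; field; rewrite gt_eqF.
    by rewrite ler_norml /g => /andP[? ?]; apply/andP; split; lra.
  have gE mu : mean mu g = c * mean mu f + 2^-1.
    by rewrite meanD// meanZ// mean_cst.
  have gl : mean mu g @[mu --> U] --> c * l + 2^-1.
    rewrite (funext gE); apply: cvgD; [exact: cvgMl_tmp | exact: cvg_cst].
  have := bounded01 g cg g01 _ gl.
  by rewrite gE lerD2r ler_pM2l.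
exists nu => f cf; have [M M0 fM] := continuous_bounded compactX cf.
have bm mu : `[- M, M]%classic (mean mu f).
  have ccst (a : R) : continuous (fun _ : X => a) by move=> x; exact: cvg_cst.
  rewrite /= in_itv/= -{1}(mean_cst mu (- M)) -{2}(mean_cst mu M).
  by apply/andP; split; apply: mean_le => // x; have := fM x;
    rewrite ler_norml => /andP[].
have [l _ fl] := ultra_cvg_compact UU (@segment_compact R (- M) M) bm.
have -> // : mean nu f = l.
apply/eqP; rewrite eq_le (le_lim f cf l fl)/=.
have Nf mu : mean mu (fun x => -1 * f x) = - mean mu f.
  by rewrite meanZ// mulN1r.
have := le_lim (fun x => -1 * f x) _ (- l).
rewrite Nf lerN2; apply; first by move=> x; apply: cvgMl_tmp; exact: cf.
by rewrite (funext Nf); exact: cvgN.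
Qed.

End layer_cake.

(** * Metrics for the weak-star topology *)

Lemma ultra_fmap (I J : Type) (f : I -> J) (U : set_system I) :
  UltraFilter U -> UltraFilter (f @ U).
Proof.
move=> UU; split; first exact: fmap_proper_filter.
move=> G GF UG; apply/seteqP; split => // A GA.
have [//|UnA] := in_ultra_setVsetC (f @^-1` A) UU.
by have /filter_ex[x []] : G (A `&` ~` A) by apply: filterI => //; exact: UG.
Qed.

Lemma ptws_cvg (I : Type) (V : topologicalType) (F : set_system (I -> V))
    (f : I -> V) : Filter F ->
  (forall i, (fun g => g i) @ F --> f i) -> F --> (f : {ptws I -> V}).
Proof.
move=> FF Ff; apply/cvg_sup => i A [_ [[B oB <-] Bf] BA].
by apply: filterS BA _; apply: Ff; exact: open_nbhs_nbhs.
Qed.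

Section weak_star_metric.
Context (R : realType) (X : pmetricType R).
Hypothesis compactX : compact [set: X].
Context (dM : borel_prob X -> borel_prob X -> R) (dM_compat : weak_star_metric dM).
Implicit Types (f : X -> R) (mu nu : borel_prob X).

(** A ball of [dM] is weak-star open, hence the preimage under [integrals] of a set open for
    pointwise convergence, which is the convergence assumed. *)
Lemma weak_star_cvg_dist (I : Type) (F : set_system I) {FF : Filter F}
    (mu_ : I -> borel_prob X) mu :
  (forall f, continuous f -> mean (mu_ i) f @[i --> F] --> mean mu f) ->
  forall e : R, 0 < e -> \forall i \near F, dM mu (mu_ i) < e.
Proof.
move=> cvg_mean e e0; have [[dxx _ _ dtri] dopen] := dM_compat.
have /dopen : forall nu, dM mu nu < e ->
    exists2 r : R, 0 < r & [set nu' | dM nu nu' < r] `<=` [set nu | dM mu nu < e].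
  move=> nu munu; exists (e - dM mu nu); first by rewrite subr_gt0.
  by move=> nu' /= H; rewrite (le_lt_trans (dtri _ nu _))// -ltrBrDl.
move=> [B oB BE].
have Bmu : B (integrals mu).
  by have : (integrals (X := X) @^-1` B) mu by rewrite BE /= dxx.
have : (integrals (X := X) \o mu_) @ F -->
    (integrals mu : {ptws continuousType X R -> R}).
  by apply: ptws_cvg => f; apply: cvg_mean; exact: cts_fun.
move=> /(_ B (open_nbhs_nbhs (conj oB Bmu))).
apply: (@filterS _ F) => i Bi.
by have : (integrals (X := X) @^-1` B) (mu_ i) by []; rewrite BE.
Qed.

(** By contradiction: pairs at distance at least [e] that finer and finer test families fail to tell
    apart generate a filter. Along an ultrafilter above it both components have weak limits with the
    same integrals, so the pairs become close. *)
Lemma exists_test_functions (e : R) : 0 < e ->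
  exists (m : nat) (f : 'I_m -> X -> R) (t : R),
  [/\ 0 < t, forall j, continuous (f j), forall j x, `|f j x| <= 1 &
    forall mu nu, (forall j, `|mean mu (f j) - mean nu (f j)| < t) ->
      dM mu nu < e].
Proof.
move=> e0; have [[_ _ dsym dtri] _] := dM_compat.
apply: contrapT => H.
pose D := [set p : {m & 'I_m -> X -> R} * R | [/\ 0 < p.2,
  forall j, continuous (projT2 p.1 j) & forall j x, `|projT2 p.1 j x| <= 1]].
pose B (p : {m & 'I_m -> X -> R} * R) :=
  [set q : borel_prob X * borel_prob X | (forall j,
    `|mean q.1 (projT2 p.1 j) - mean q.2 (projT2 p.1 j)| < p.2) /\
    e <= dM q.1 q.2].
have FB : Filter (filter_from D B).
  apply: filter_from_filter.
    exists (existT (fun m => 'I_m -> X -> R) 0%N (fun _ _ => 0), 1).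
    by split => //=; case.
  move=> [[J f] t] [[J' f'] t'] [/= t0 cf f1] [/= t'0 cf' f'1].
  exists (existT (fun m => 'I_m -> X -> R) (J + J')%N (fun j =>
    match fintype.split j with inl j => f j | inr j => f' j end), Num.min t t').
    by split => /= [|j|j]; [rewrite lt_min t0 | case: (fintype.split j)..].
  move=> [mu nu] [/= close emunu]; split; split => //= j.
    by have := close (lshift _ j); rewrite (unsplitK (inl j)) lt_min => /andP[].
  by have := close (rshift _ j); rewrite (unsplitK (inr j)) lt_min => /andP[].
have PB : ProperFilter (filter_from D B).
  apply: filter_from_proper => -[[J f] t] [/= t0 cf f1].
  apply: contrapT => nB; apply: H; exists J, f, t; split => // mu nu close.
  by rewrite ltNge; apply/negP => emunu; apply: nB; exists (mu, nu).
have [U [UU BU]] := ultraFilterLemma PB.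
have [nu1 cvg1] := ultra_weak_limit compactX (ultra_fmap fst UU).
have [nu2 cvg2] := ultra_weak_limit compactX (ultra_fmap snd UU).
have nu12 f : continuous f -> mean nu2 f = mean nu1 f.
  move=> cf; have [M M0 fM] := continuous_bounded compactX cf.
  have cMf : continuous (fun x => M^-1 * f x).
    by move=> x; apply: cvgMl_tmp; exact: cf.
  apply/eqP; rewrite -subr_eq0 -normr_le0; apply/ler_addgt0Pl => r r0; rewrite addr0.
  have c12 : `|mean q.2 f - mean q.1 f| @[q --> U] --> `|mean nu2 f - mean nu1 f|.
    by apply: cvg_norm; apply: cvgB; [exact: cvg2 | exact: cvg1].
  apply: (cvgr_to_le c12); apply: BU.
  (* The single test function [f / M], with tolerance [r / M], controls the integrals of [f] up to
     [r]. *)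
  exists (existT (fun m => 'I_m -> X -> R) 1%N
    (fun _ x => M^-1 * f x), M^-1 * r).
    split => //=; first by rewrite mulr_gt0 ?invr_gt0.
    move=> _ x; rewrite normrM gtr0_norm ?invr_gt0// ler_pdivrMl// mulr1.
    exact: fM.
  move=> q [/= /(_ ord0) + _]; rewrite !meanZ// -mulrBr normrM gtr0_norm ?invr_gt0//.
  by rewrite ltr_pM2l ?invr_gt0// distrC => /ltW.
have near1 : \forall q \near U, dM nu1 q.1 < e / 2.
  by apply: weak_star_cvg_dist; [exact: cvg1 | rewrite divr_gt0].
have near2 : \forall q \near U, dM nu1 q.2 < e / 2.
  apply: weak_star_cvg_dist; last by rewrite divr_gt0.
  by move=> f cf; rewrite -nu12//; exact: cvg2.
have near3 : \forall q \near U, e <= dM q.1 q.2.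
  apply: BU; exists (existT (fun m => 'I_m -> X -> R) 0%N (fun _ _ => 0), 1).
    by split => //=; case.
  by move=> q [].
have /filter_ex[q [[d1 d2] d3]] :
    \forall q \near U, (dM nu1 q.1 < e / 2 /\ dM nu1 q.2 < e / 2) /\ e <= dM q.1 q.2.
  by apply: filterI => //; exact: filterI.
have := dtri q.1 nu1 q.2; rewrite (dsym q.1 nu1) leNgt => /negP; apply.
by rewrite (lt_le_trans _ d3)// [ltRHS](splitr e) ltrD.
Qed.

(** The same ultrafilter argument in [X]: offending pairs would have limits with equal Dirac
    measures, hence equal limits, although they stay [e] apart. *)
Lemma dirac_prob_separates (e : R) : 0 < e ->
  exists2 r : R, 0 < r &
    forall x y, dM (dirac_prob x) (dirac_prob y) < r -> mdist x y < e.
Proof.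
move=> e0; have [[_ deq dsym dtri] _] := dM_compat.
apply: contrapT => H.
pose B (r : R) := [set q : X * X | dM (dirac_prob q.1) (dirac_prob q.2) < r /\
  e <= mdist q.1 q.2].
have FB : Filter (filter_from [set r : R | 0 < r] B).
  apply: filter_from_filter; first by exists 1; exact: ltr01.
  move=> r s /= r0 s0; exists (Num.min r s); first by rewrite /= lt_min r0.
  by move=> q [/= + ?]; rewrite lt_min => /andP[].
have PB : ProperFilter (filter_from [set r : R | 0 < r] B).
  apply: filter_from_proper => r /= r0; apply: contrapT => nB.
  apply: H; exists r => // x y xy; rewrite ltNge; apply/negP => exy.
  by apply: nB; exists (x, y).
have [U [UU BU]] := ultraFilterLemma PB.
have [x0 _ x0U] := ultra_cvg_compact (f := fst) UU compactX (fun=> I).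
have [y0 _ y0U] := ultra_cvg_compact (f := snd) UU compactX (fun=> I).
have dirac_cvg z (g : X * X -> X) : g @ U --> z -> forall r : R, 0 < r ->
    \forall q \near U, dM (dirac_prob z) (dirac_prob (g q)) < r.
  move=> gz; apply: weak_star_cvg_dist => f cf.
  rewrite mean_dirac//; under eq_fun do rewrite mean_dirac//.
  by apply: cvg_comp gz _; exact: cf.
have x0y0 : x0 = y0.
  have dxy : dirac_prob x0 = dirac_prob y0.
    apply: deq; apply/eqP; rewrite eq_le; apply/andP; split.
      apply/ler_addgt0Pl => r r0; rewrite addr0.
      have r3 : 0 < r / 3 by rewrite divr_gt0.
      have Ur : \forall q \near U, dM (dirac_prob q.1) (dirac_prob q.2) < r / 3.
        by apply: BU; exists (r / 3) => // q [].
      have /filter_ex[q [[d1 d2] d3]] : \forall q \near U,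
          (dM (dirac_prob x0) (dirac_prob q.1) < r / 3 /\
           dM (dirac_prob y0) (dirac_prob q.2) < r / 3) /\
          dM (dirac_prob q.1) (dirac_prob q.2) < r / 3.
        apply: filterI => //; apply: filterI.
          exact: (dirac_cvg x0 fst x0U).
        exact: (dirac_cvg y0 snd y0U).
      have := dtri (dirac_prob x0) (dirac_prob q.1) (dirac_prob y0).
      have := dtri (dirac_prob q.1) (dirac_prob q.2) (dirac_prob y0).
      by rewrite (dsym (dirac_prob q.2) (dirac_prob y0)); lra.
    have := dtri (dirac_prob x0) (dirac_prob y0) (dirac_prob x0).
    have [[-> _ _ _] _] := dM_compat.
    by rewrite (dsym (dirac_prob y0)); lra.
  (* Integrating the distance to [x0] recovers the point from its Dirac measure. *)
  have cd : continuous (mdist x0).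
    move=> z; apply/cvgrPdist_lt => r r0.
    have : nbhs z (ball z r) by exact: nbhsx_ballx.
    apply: filterS => w; rewrite ballEmdist/= => zw.
    have := metric_triangle x0 z w; have := metric_triangle x0 w z.
    by rewrite (metric_sym w) ltr_distlC => *; apply/andP; split; lra.
  apply: mdist_positivity.
  by rewrite -(mean_dirac y0 cd) -dxy mean_dirac// mdistxx.
rewrite -{}x0y0 in y0U.
have e2 : 0 < e / 2 by rewrite divr_gt0.
have Ue : \forall q \near U, e <= mdist q.1 q.2.
  by apply: BU; exists 1; [exact: ltr01 | move=> q []].
have /filter_ex[q [[]]] : \forall q \near U,
    (ball x0 (e / 2) q.1 /\ ball x0 (e / 2) q.2) /\ e <= mdist q.1 q.2.
  apply: filterI => //; apply: filterI.
    exact: x0U (nbhsx_ballx x0 _ e2).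
  exact: y0U (nbhsx_ballx x0 _ e2).
rewrite !ballEmdist /= => d1 d2 d3.
by have := metric_triangle q.1 x0 q.2; rewrite (metric_sym q.1 x0); lra.
Qed.

End weak_star_metric.

(** * Sampling *)

(** Since [expR (- y)] is at least [1 - y], [expR y] is at most the inverse of [1 - y]; and [1 - y]
    times the right-hand side is [1 + y ^+ 2 * (1 - 2 * y)], at least 1. *)
Lemma expR_le_quadratic (R : realType) (y : R) : y <= 2^-1 ->
  expR y <= 1 + y + 2 * y ^+ 2.
Proof.
move=> y2; have y1 : 0 < 1 - y by lra.
rewrite -(opprK y) expRN opprK -[leRHS]invrK lef_pV2 ?posrE ?expR_gt0//; last first.
  by rewrite invr_gt0; nra.
apply: le_trans (expR_ge1Dx (- y)).
rewrite -[leRHS]invrK lef_pV2 ?posrE ?invr_gt0//; last nra.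
by rewrite -[leLHS]mul1r ler_pdivrMr//; nra.
Qed.

Section sampling.
Context (R : realType) (X : pmetricType R).
Hypothesis compactX : compact [set: X].
Implicit Types (mu : borel_prob X).

Lemma continuous_sumr (J : finType) (F : J -> X -> R) :
  (forall j, continuous (F j)) -> continuous (fun x => \sum_j F j x).
Proof.
by move=> cF x; apply: cvg_big => // [|j _]; [exact: add_continuous | exact: cF].
Qed.

Lemma mean_sum mu (J : finType) (F : J -> X -> R) :
  (forall j, continuous (F j)) ->
  mean mu (fun x => \sum_j F j x) = \sum_j mean mu (F j).
Proof.
move=> cF.
suff: forall s : seq J, continuous (fun x => \sum_(j <- s) F j x) /\
  mean mu (fun x => \sum_(j <- s) F j x) = \sum_(j <- s) mean mu (F j).
  by move=> /(_ (index_enum J))[].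
elim=> [|j s [cS IH]].
  rewrite (_ : (fun x => _) = (fun=> 0)).
    by rewrite mean_cst big_nil; split => // x; exact: cvg_cst.
  by apply/funext => x; rewrite big_nil.
rewrite (_ : (fun x => _) = (fun x => F j x + \sum_(i <- s) F i x)).
  split; last by rewrite big_cons meanD// IH.
  by move=> x; apply: cvgD; [exact: cF | exact: cS].
by apply/funext => x; rewrite big_cons.
Qed.

(* Maurey's empirical method, derandomized: the sample points are chosen one
   after the other so as to keep the exponential moments below their mean. *)
Lemma exists_sample (e : R) : 0 < e <= 1 -> exists2 q : R, 0 < q < 1 &
  forall (J : finType) (g : J -> X -> R) mu (k : nat),
    (forall j, continuous (g j)) -> (forall j x, `|g j x| <= 1) ->
  exists2 xs : seq X, size xs = k &
    #|[pred j | k%:R * (mean mu (g j) + e) <= \sum_(x <- xs) g j x]|%:R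
      <= #|J|%:R * q ^+ k.
Proof.
move=> /andP[e0 e1]; pose s := e / 16.
have s0 : 0 < s by rewrite divr_gt0.
have se : s * 16 = e by rewrite /s; field.
(* A bound for the mean of each [h j] below. As [s * e = 16 * s ^+ 2], the gain [expR (- (s * e))]
   beats the second-order term [8 * s ^+ 2], whence [q < 1]. *)
pose q := (1 + 8 * s ^+ 2) * expR (- (s * e)).
exists q.
  rewrite mulr_gt0 ?expR_gt0//=; last by nra.
  rewrite /q expRN ltr_pdivrMr ?expR_gt0// mul1r.
  by apply: lt_le_trans (expR_ge1Dx _); nra.
move=> J g mu k cg g1.
have m1 j : `|mean mu (g j)| <= 1.
  have ccst (a : R) : continuous (fun _ : X => a) by move=> x; exact: cvg_cst.
  rewrite ler_norml -{1}(mean_cst mu (- 1)) -{2}(mean_cst mu 1).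
  by apply/andP; split; apply: mean_le => // x; have := g1 j x;
    rewrite ler_norml => /andP[].
pose h j x := expR (s * (g j x - mean mu (g j) - e)).
have ch j : continuous (h j).
  move=> x; apply: continuous_comp; last exact: continuous_expR.
  apply: cvgMl_tmp; apply: cvgB; last exact: cvg_cst.
  by apply: cvgB; [exact: cg | exact: cvg_cst].
have hq j : mean mu (h j) <= q.
  pose c := expR (- (s * e)) * s.
  have cc : continuous (fun x => c * g j x) by move=> x; apply: cvgMl_tmp; exact: cg.
  have ccst (a : R) : continuous (fun _ : X => a) by move=> x; exact: cvg_cst.
  (* This affine function of [g j] dominates [h j] by the quadratic bound on the exponential; its
     first-order term is centred, so its mean is [q]. *)
  apply: (@le_trans _ _ (mean mu (fun x => c * g j x + (q - c * mean mu (g j))))).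
    apply: mean_le => // x; first by apply: cvgD; [exact: cc | exact: ccst].
    have -> : h j x = expR (- (s * e)) * expR (s * (g j x - mean mu (g j))).
      by rewrite /h -expRD; congr expR; ring.
    have -> : c * g j x + (q - c * mean mu (g j)) = expR (- (s * e)) *
        (1 + s * (g j x - mean mu (g j)) + 8 * s ^+ 2).
      by rewrite /q /c; ring.
    rewrite ler_pM2l ?expR_gt0//; have := g1 j x; have := m1 j.
    rewrite !ler_norml => /andP[? ?] /andP[? ?].
    apply: (le_trans (expR_le_quadratic _)); first nra.
    rewrite lerD2l exprMn.
    have : (g j x - mean mu (g j)) ^+ 2 <= 4 by nra.
    have : 0 < s ^+ 2 by rewrite exprn_gt0.
    by nra.
  by rewrite meanD// meanZ// mean_cst; lra.
have [xs sxs Pxs] : exists2 xs : seq X, size xs = k &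
    \sum_j \prod_(x <- xs) h j x <= #|J|%:R * q ^+ k.
  elim: k => [|k [xs sxs Pxs]].
    exists [::] => //; under eq_bigr do rewrite big_nil.
    by rewrite sumr_const expr0 mulr1.
  have cwh j : continuous (fun x => (\prod_(y <- xs) h j y) * h j x).
    by move=> x; apply: cvgMl_tmp; exact: ch.
  have [x xle] := exists_le_mean compactX mu (continuous_sumr cwh).
  exists (x :: xs); first by rewrite /= sxs.
  under eq_bigr do rewrite big_cons mulrC.
  apply: (le_trans xle); rewrite mean_sum//.
  apply: (@le_trans _ _ (\sum_j (\prod_(y <- xs) h j y) * q)).
    apply: ler_sum => j _; rewrite meanZ//; apply: ler_wpM2l; last exact: hq.
    by apply: prodr_ge0 => y _; exact: expR_ge0.
  rewrite -mulr_suml exprSr mulrA ler_wpM2r//.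
  by rewrite mulr_ge0 ?expR_ge0//; nra.
(* Markov: at a bad index the product is the exponential of a nonnegative number, hence at least
   1. *)
exists xs => //; apply: le_trans Pxs.
rewrite -sum1_card natr_sum [leRHS](bigID [pred j |
  k%:R * (mean mu (g j) + e) <= \sum_(x <- xs) g j x])/=.
rewrite -[leLHS]addr0; apply: lerD; last first.
  by apply: sumr_ge0 => j _; apply: prodr_ge0 => y _; exact: expR_ge0.
apply: ler_sum => j; rewrite inE => bad.
rewrite -expR_sum -[leLHS]expR0 ler_expR -mulr_sumr mulr_ge0 ?(ltW s0)//.
rewrite sumrB sumrB !big_const_seq !count_predT !iter_addr_0 sxs.
by rewrite -mulr_natl -[e *+ _]mulr_natl; lra.
Qed.

End sampling.

(** * Counting codes *)

Lemma uniformly_equicontinuous (R : realType) (X : pmetricType R) (J : finType)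
    (f : J -> X -> R) (e : R) :
  compact [set: X] -> (forall j, continuous (f j)) -> 0 < e ->
  exists2 d : R, 0 < d &
    forall j x y, mdist x y < d -> `|f j x - f j y| < e.
Proof.
move=> compactX cf e0.
have unif j : \forall d \near (0 : R)^'+,
    forall x y, mdist x y < d -> `|f j x - f j y| < e.
  have /compact_near_coveringP/(_ R (0 : R)^'+ (fun d x => forall y,
    mdist x y < d -> `|f j x - f j y| < e) _) : compact [set: X] by [].
  move=> near_cov; have {near_cov} : \forall d \near (0 : R)^'+,
      [set: X] `<=` (fun x => forall y, mdist x y < d -> `|f j x - f j y| < e).
    apply: near_cov => x _.
    have e2 : 0 < e / 2 by rewrite divr_gt0.
    have /cvgrPdist_lt/(_ _ e2)/nbhs_ballP[r /= r0 rf] := cf j x.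
    have r2 : 0 < r / 2 by rewrite divr_gt0.
    exists (ball x (r / 2), [set d | 0 < d /\ d < r / 2]).
      split; first exact: nbhsx_ballx.
      by apply: filterI; [exact: nbhs_right_gt | exact: nbhs_right_lt].
    move=> [x' d] [/=]; rewrite ballEmdist /= => xx' [_ dr] y x'y.
    have xx'r : ball x r x' by rewrite ballEmdist /=; lra.
    have xyr : ball x r y.
      by rewrite ballEmdist /=; have := metric_triangle x x' y; lra.
    have := rf _ xx'r; have := rf _ xyr; rewrite /= !ltr_norml.
    by move=> /andP[? ?] /andP[? ?]; apply/andP; split; lra.
  by apply: filterS => d cov x y; exact: cov.
have /filter_ex[d [d0 dP]] : \forall d \near (0 : R)^'+, 0 < d /\
    forall j x y, mdist x y < d -> `|f j x - f j y| < e.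
  by apply: filterI; [exact: nbhs_right_gt | exact: (@filter_forall _ _ _ _ _ unif)].
by exists d.
Qed.

(** [dyn_dist] is a maximum with default value 0, so [e] has to be positive. *)
Lemma dyn_dist_lt (R : realType) (X : choiceType) (d : X -> X -> R) (T : X -> X)
    n (e : R) x y : 0 < e ->
  dyn_dist d T n x y < e <-> forall t, (t < n)%N -> d (iter t T x) (iter t T y) < e.
Proof.
move=> e0; split=> [/bigmax_ltP[_ H] t tn|H]; first exact: (H (Ordinal tn)).
by apply/bigmax_ltP; split => // t _; exact: H.
Qed.

(* Exponential Markov bound, with weight [expR (- tau)] per entry of the
   support. *)
Lemma card_small_support (R : realType) (V : finType) n (r tau : R) : 0 <= tau ->
  #|[pred w : {ffun 'I_n -> option V} | #|[pred t | w t != None]|%:R <= r]|%:R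
    <= expR (tau * r + n%:R * #|V|%:R * expR (- tau)).
Proof.
move=> tau0; set W := [pred w | _].
pose b (o : option V) : R := expR (- tau * (o != None)%:R).
have bsum : \sum_o b o = 1 + #|V|%:R * expR (- tau).
  rewrite (bigD1 None)//= /b eqxx mulr0 expR0; congr (_ + _).
  rewrite (eq_bigr (fun=> expR (- tau))); last first.
    by move=> o ->; rewrite mulr1.
  by rewrite sumr_const (@cardC1 (option V)) card_option mulr_natl.
have bprod (w : {ffun 'I_n -> option V}) :
    \prod_t b (w t) = expR (- tau * #|[pred t | w t != None]|%:R).
  rewrite -expR_sum -mulr_sumr; congr (expR (_ * _)).
  rewrite -sum1_card natr_sum [RHS]big_mkcond; apply: eq_bigr => t _ /=.
  by rewrite inE; case: (w t).
rewrite -sum1_card natr_sum.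
apply: (@le_trans _ _ (\sum_(w : {ffun 'I_n -> option V})
    expR (tau * r) * \prod_t b (w t))).
  rewrite [leLHS]big_mkcond; apply: ler_sum => w _; case: ifPn => [|_].
    rewrite inE => wr; rewrite bprod -expRD -[leLHS]expR0 ler_expR mulNr subr_ge0.
    exact: ler_wpM2l.
  by rewrite mulr_ge0 ?expR_ge0//; apply: prodr_ge0 => t _; exact: expR_ge0.
(* The sum of the product weights over all words factorizes into the [n]-th power of
   [1 + #|V|%:R * expR (- tau)], bounded through [1 + x <= expR x]. *)
rewrite -mulr_sumr -(bigA_distr_bigA (fun _ => b)) prodr_const card_ord bsum.
rewrite expRD ler_pM2l ?expR_gt0// -mulrA expRM_natl.
by rewrite lerXn2r ?nnegrE ?expR_ge0 ?addr_ge0 ?mulr_ge0 ?expR_ge0 ?expR_ge1Dx.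
Qed.

(** In a code the tuple is the rounded sample; the word has [None] at ordinary times and a grid cell
    at the exceptional ones, of which there are at most [r]. *)
Lemma size_codes_le (R : realType) (M : eqType) (V : finType) N k n (r tau : R)
    (s : seq M) (c : M -> k.-tuple 'I_N * {ffun 'I_n -> option V}) :
  0 <= tau -> uniq s -> {in s &, injective c} ->
  (forall mu, #|[pred t | (c mu).2 t != None]|%:R <= r) ->
  (size s)%:R <= N%:R ^+ k * expR (tau * r + n%:R * #|V|%:R * expR (- tau)).
Proof.
move=> tau0 us injc cr; pose W := finset (fun w : {ffun 'I_n -> option V} =>
  #|[pred t | w t != None]|%:R <= r).
have scW : (size s <= #|finset.setX [set: k.-tuple 'I_N]%SET W|)%N.
  rewrite -(size_map c) -(card_uniqP _) ?map_inj_in_uniq//.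
  by apply/subset_leq_card/fintype.subsetP => _ /mapP[mu _ ->]; rewrite !inE /=.
apply: (@le_trans _ _ (#|finset.setX [set: k.-tuple 'I_N]%SET W|%:R)).
  by rewrite ler_nat.
rewrite cardsX cardsT card_tuple card_ord natrM natrX.
by rewrite ler_wpM2l ?exprn_ge0// cardsE card_small_support.
Qed.

Lemma truncn_dist_lt (R : archiRealFieldType) (x y : R) : 0 <= x -> 0 <= y ->
  Num.truncn x = Num.truncn y -> `|x - y| < 1.
Proof.
move=> x0 y0 xy; have /andP[] := truncn_itv x0; have /andP[] := truncn_itv y0.
rewrite xy -natr1 => ? ? ? ?; rewrite ltr_norml; apply/andP; split; lra.
Qed.

(** * Encoding measures by samples along orbits *)

Section induced_system.
Context (R : realType) (X : pmetricType R).
Hypothesis compactX : compact [set: X].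
Variable T : continuousType X X.
Implicit Types (mu nu : borel_prob X).

(** Sampling is applied at once to all [f i] composed with iterates of [T], with both signs to make
    the bound two-sided; the [2 * n * m] indices give the factor in front of [q ^+ k]. *)
Lemma exists_orbit_sample m (f : 'I_m -> X -> R) (e : R) :
  (forall i, continuous (f i)) -> (forall i x, `|f i x| <= 1) -> 0 < e <= 1 ->
  exists2 q : R, 0 < q < 1 & forall n k mu, exists xs : k.-tuple X,
    #|[pred t : 'I_n | [exists i, k%:R * e <=
      `|\sum_(x <- xs) f i (iter t T x) - k%:R * mean mu (f i \o iter t T)|]]|%:R
    <= n%:R * m%:R * 2 * q ^+ k.
Proof.
move=> cf f1 e01; have [q q01 qP] := exists_sample compactX e01.
exists q => // n k mu.
pose g (j : 'I_n * 'I_m * bool) x := (-1) ^+ j.2 * f j.1.2 (iter j.1.1 T x).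
have cfT i t : continuous (f i \o iter t T).
  move=> x; apply: continuous_comp; [exact: continuous_iter | exact: cf].
have cg j : continuous (g j) by move=> x; apply: cvgMl_tmp; exact: cfT.
have g1 j x : `|g j x| <= 1 by rewrite normrM normr_sign mul1r.
have [xs /eqP sxs xsP] := qP _ g mu k cg g1.
exists (Tuple sxs); apply: le_trans (le_trans xsP _); last first.
  by rewrite !card_prod !card_ord card_bool !natrM.
rewrite ler_nat; set bad := (X in (_ <= #|X|)%N).
apply: leq_trans (leq_imset_card (fun j : 'I_n * 'I_m * bool => j.1.1) bad).
apply/subset_leq_card/fintype.subsetP => t; rewrite inE => /existsP[i ti].
have gE (b : bool) : \sum_(x <- xs) g (t, i, b) x =
    (-1) ^+ b * \sum_(x <- xs) f i (iter t T x) by rewrite mulr_sumr.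
have mE (b : bool) : mean mu (g (t, i, b)) = (-1) ^+ b * mean mu (f i \o iter t T).
  exact: (meanZ compactX mu ((-1) ^+ b) (cfT i t)).
have [pos|neg] := leP 0 (\sum_(x <- xs) f i (iter t T x) -
    k%:R * mean mu (f i \o iter t T)).
  apply/imsetP; exists (t, i, false) => //; rewrite inE /= gE mE !mul1r.
  by move: ti; rewrite ger0_norm//= mulrDr; lra.
apply/imsetP; exists (t, i, true) => //; rewrite inE /= gE mE !mulN1r.
by move: ti; rewrite ltr0_norm//= mulrDr; lra.
Qed.

Context (dM : borel_prob X -> borel_prob X -> R) (dM_compat : weak_star_metric dM).

(* A measure is encoded by its sample, rounded to the spanning set [E], and, at
   each exceptional time of the sample, by the cell of a grid containing its
   integrals; measures with equal codes are [e]-close at all times. *)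
Lemma separated_measures_bound (e : R) : 0 < e ->
  exists (d q : R) (m K : nat), [/\ 0 < d, 0 < q < 1 &
  forall n k N (tau : R) (E : 'I_N -> X), 0 <= tau ->
    (forall x, exists i, dyn_dist (@mdist R X) T n x (E i) < d) ->
  forall s : seq (borel_prob X), uniq s ->
    dyn_separated dM (push_prob T) n e [set` s] ->
  (size s)%:R <= N%:R ^+ k *
    expR (tau * (n%:R * m%:R * 2 * q ^+ k) + n%:R * K%:R * expR (- tau))].
Proof.
move=> e0; have [m [f [th0 [th00 cf f1 fclose]]]] :=
  exists_test_functions compactX dM_compat e0.
(* Capped at 1 because sampling takes a tolerance of at most 1. It is spent in quarters: one for the
   sampling error of each measure, one for rounding each sample to [E]. *)
pose th := Num.min th0 1.
have th_gt0 : 0 < th by rewrite lt_min th00 ltr01.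
have th_le : th <= th0 by rewrite ge_min lexx.
have th_le1 : th <= 1 by rewrite ge_min lexx orbT.
have th4 : 0 < th / 4 <= 1 by apply/andP; split; lra.
have [q q01 sample] := exists_orbit_sample cf f1 th4.
have [d d0 fd] := uniformly_equicontinuous compactX cf (proj1 (andP th4)).
(* Means lie between -1 and 1, so [val] lies between 0 and [2 / th] and its truncation takes at most
   [L] values. *)
pose L := (Num.truncn (2 / th)).+1.
pose V : finType := {ffun 'I_m -> 'I_L}.
exists d, q, m, #|V|; split => // n k N tau E tau0 /choice[idx idxP] s us sep.
have /choice[xs xsP] := sample n k.
pose bad mu (t : 'I_n) := [exists i, k%:R * (th / 4) <=
  `|\sum_(x <- xs mu) f i (iter t T x) - k%:R * mean mu (f i \o iter t T)|].
pose val mu (t : 'I_n) i := (mean mu (f i \o iter t T) + 1) / th.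
pose cell mu t : V := [ffun i => inord (Num.truncn (val mu t i))].
pose c mu : k.-tuple 'I_N * {ffun 'I_n -> option V} :=
  ([tuple of map idx (xs mu)],
   [ffun t => if bad mu t then Some (cell mu t) else None]).
have cfT i (t : nat) : continuous (f i \o iter t T).
  move=> x; apply: continuous_comp; [exact: continuous_iter | exact: cf].
have val_itv mu t i : 0 <= val mu t i <= 2 / th.
  have ccst (a : R) : continuous (fun _ : X => a) by move=> x; exact: cvg_cst.
  rewrite ler_pM2r ?invr_gt0// mulr_ge0 ?invr_ge0 ?(ltW th_gt0)//=; last first.
    rewrite -lerBlDr sub0r -[leLHS](mean_cst mu); apply: mean_le => // x.
    by have := f1 i (iter t T x); rewrite ler_norml => /andP[].
  rewrite -lerBrDr (_ : 2 - 1 = 1); last by ring.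
  rewrite -[leRHS](mean_cst mu); apply: mean_le => // x.
  by have := f1 i (iter t T x); rewrite ler_norml => /andP[].
apply: (size_codes_le (c := c)) => //; last first.
  move=> mu; apply: le_trans (xsP mu); rewrite ler_nat.
  apply/subset_leq_card/fintype.subsetP => t; rewrite !inE ffunE.
  by rewrite -/(bad mu t); case: (bad mu t).
move=> mu nu mus nus [idxE wE].
apply: contrapT => mu_nu.
have := sep mu nu mus nus mu_nu; rewrite leNgt => /negP; apply.
apply/dyn_dist_lt => // t' t'n; pose t := Ordinal t'n.
apply: fclose => i; apply: lt_le_trans th_le.
rewrite !(mean_iter_push compactX)// -[t']/(nat_of_ord t).
have := congr1 (fun w : {ffun 'I_n -> option V} => w t) wE; rewrite !ffunE.
(* Equal words make [t] exceptional for both measures or for neither. In the first case the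
   integrals share a grid cell of width [th]. *)
case: ifPn => badmu; case: ifPn => badnu //; first move=> [cellE].
  have := congr1 (fun v : V => nat_of_ord (v i)) cellE; rewrite !ffunE.
  have inordE rho : @inord (Num.truncn (2 / th)) (Num.truncn (val rho t i)) =
      Num.truncn (val rho t i) :> nat.
    rewrite inordK// ltnS; apply: le_truncn.
    by case/andP: (val_itv rho t i).
  rewrite !inordE => /truncn_dist_lt.
  case/andP: (val_itv mu t i) => -> _; case/andP: (val_itv nu t i) => -> _.
  move=> /(_ isT isT); rewrite /val -mulrBl opprD addrACA subrr addr0 normrM.
  by rewrite [X in _ * X]gtr0_norm ?invr_gt0// ltr_pdivrMr// mul1r.
(* At an ordinary time the integrals are near the sample averages, and both samples round to the
   same points of [E]. *)
have close rho : ~~ bad rho t ->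
    `|\sum_(x <- xs rho) f i (iter t T x) - k%:R * mean rho (f i \o iter t T)|
      < k%:R * (th / 4).
  by move=> /existsPn/(_ i); rewrite -ltNge.
have := close _ badmu; have := close _ badnu.
have : `|\sum_(x <- xs mu) f i (iter t T x) - \sum_(x <- xs nu) f i (iter t T x)|
    <= k%:R * (th / 2).
  rewrite !big_tuple -sumrB (le_trans (ler_norm_sum _ _ _))//.
  rewrite mulr_natl -[k in leRHS]card_ord -sumr_const; apply: ler_sum => l _.
  have idxl : idx (tnth (xs mu) l) = idx (tnth (xs nu) l).
    have := congr1 (fun u => nth (idx point) u l) idxE.
    by rewrite !(nth_map point) ?size_tuple// -!tnth_nth.
  have dE x : mdist (iter t T x) (iter t T (E (idx x))) < d.
    exact: (proj1 (dyn_dist_lt _ _ _ _ _ d0) (idxP x)).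
  have := fd i _ _ (dE (tnth (xs mu) l)); have := fd i _ _ (dE (tnth (xs nu) l)).
  rewrite idxl !ltr_norml => /andP[? ?] /andP[? ?].
  rewrite ler_norml; apply/andP; split; lra.
move=> /ler_normlP[? ?] /ltr_normlP[? ?] /ltr_normlP[? ?] _.
(* The strict sampling bound rules out [k = 0]. *)
have kpos : 0 < k%:R :> R by rewrite -(pmulr_lgt0 _ (proj1 (andP th4))); lra.
by apply/ltr_normlP; split; rewrite -(ltr_pM2l kpos); lra.
Qed.

End induced_system.

(** * Separation numbers and entropy *)

Section limn_esup_near.
Context (R : realType).
Local Open Scope ereal_scope.
Implicit Types (u v : (\bar R)^nat) (x : \bar R).

Lemma limn_esup_lt u x : limn_esup u < x -> \forall n \near \oo, u n < x.
Proof.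
move=> /ereal_inf_lt[_ [A FA <-] supA].
by apply: filterS FA => n An; apply: le_lt_trans supA; apply: ereal_sup_ubound; exists n.
Qed.

Lemma limn_esup_le u x : (\forall n \near \oo, u n <= x) -> limn_esup u <= x.
Proof.
move=> ux; apply: (@le_trans _ _ (ereal_sup (u @` [set n | u n <= x]))).
  by apply: ereal_inf_lbound; exists [set n | u n <= x].
by apply: ge_ereal_sup => _ [n /= unx <-].
Qed.

Lemma le_limn_esup u v : (\forall n \near \oo, u n <= v n) ->
  limn_esup u <= limn_esup v.
Proof.
move=> uv; apply: le_ereal_inf_tmp => _ [A FA <-]; apply: limn_esup_le.
apply: filterS2 uv FA => n uvn An; apply: le_trans uvn _.
by apply: ereal_sup_ubound; exists n.
Qed.

Lemma limn_esup_ge0 u : (\forall n \near \oo, 0 <= u n) -> 0 <= limn_esup u.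
Proof.
move=> u0; apply: le_ereal_inf_tmp => _ [A FA <-].
have /filter_ex[n [u0n An]] : \forall n \near \oo, 0 <= u n /\ A n.
  exact: filterI.
by apply: le_trans u0n _; apply: ereal_sup_ubound; exists n.
Qed.

End limn_esup_near.

Section sep_number.
Context (R : realType) (X : choiceType) (d : X -> X -> R) (T : X -> X).
Local Open Scope ereal_scope.

Lemma counting_seq (s : seq X) : uniq s -> counting [set` s] = (size s)%:R%:E :> \bar R.
Proof.
move=> us; have fs : finite_set [set` s] by exact: finite_seq.
rewrite /counting asboolT//; congr (_%:R%:E).
have -> : fset_set [set` s] = [fset x in s]%fset.
  by apply/fsetP => x; rewrite in_fset_set// !inE; apply/idP/idP; rewrite in_setE.
by rewrite card_fseq undup_id.
Qed.

Lemma sep_number_ge0 n e : 0 <= sep_number d T n e.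
Proof.
apply: (@le_trans _ _ (counting (set0 : set X))).
  by rewrite /counting; case: asboolP.
by apply: ereal_sup_ubound; exists set0.
Qed.

Lemma size_le_sep_number n e (s : seq X) : uniq s ->
  dyn_separated d T n e [set` s] -> (size s)%:R%:E <= sep_number d T n e.
Proof.
by move=> us ss; rewrite -counting_seq//; apply: ereal_sup_ubound; exists [set` s].
Qed.

(** Finite sets suffice: an infinite separated set has finite subsets of any size, contradicting the
    bound [x]. *)
Lemma sep_number_le n e (x : R) :
  (forall s : seq X, uniq s -> dyn_separated d T n e [set` s] ->
    ((size s)%:R <= x)%R) ->
  sep_number d T n e <= x%:E.
Proof.
move=> H; apply: ge_ereal_sup => _ [F sepF <-].
have sub (A : {fset X}) : [set` A] `<=` F -> (#|` A|%:R <= x)%R.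
  by move=> AF; apply: H => // y z /AF Fy /AF Fz; exact: sepF.
rewrite /counting; case: asboolP => [finF|infF].
  by rewrite lee_fin; apply: sub => y /=; rewrite in_fset_set// => /set_mem.
have [A AF xA] := infinite_set_fset (Num.truncn x).+1 infF.
have := sub A AF; rewrite leNgt => /negP nx; exfalso; apply: nx.
by rewrite (lt_le_trans (truncnS_gt x))// ler_nat.
Qed.

Lemma le_sep_number n (e1 e2 : R) : (e1 <= e2)%R ->
  sep_number d T n e2 <= sep_number d T n e1.
Proof.
move=> e12; apply: ge_ereal_sup => _ [F sepF <-].
apply: ereal_sup_ubound; exists F => // x y Fx Fy xy.
by rewrite (le_trans e12)// sepF.
Qed.

(** A separated set of maximal size spans, for a point at distance at least [e] from all its members
    could be added. The maximum exists because sizes are bounded by [x]. *)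
Lemma exists_spanning n (e x : R) : (0 < e)%R ->
  (forall y, d y y = 0%R) -> (forall y z, d y z = d z y) ->
  sep_number d T n e <= x%:E ->
  exists N (E : 'I_N -> X), (N%:R <= x)%R /\
    forall y, exists i, (dyn_dist d T n y (E i) < e)%R.
Proof.
move=> e0 dxx dsym sx.
pose P k := `[< exists s : seq X,
  [/\ uniq s, dyn_separated d T n e [set` s] & size s = k] >].
have P0 : exists k, P k by exists 0%N; apply/asboolP; exists [::].
have Px k : P k -> (k%:R <= x)%R.
  move=> /asboolP[s [us ss <-]]; rewrite -lee_fin.
  exact: le_trans (size_le_sep_number us ss) sx.
have Pb k : P k -> (k <= Num.truncn x)%N.
  by move=> /Px kx; rewrite -(@natrK R k); exact: le_truncn.
case: (ex_maxnP P0 Pb) => N PN Nmax.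
have /asboolP[s [us ss sN]] := PN.
have dyn_sym y z : dyn_dist d T n y z = dyn_dist d T n z y.
  by apply: eq_bigr => i _; rewrite dsym.
exists N, (tnth (Tuple (introT eqP sN))); split; first exact: Px.
move=> y; apply: contrapT => /forallNP far.
have {}far z : z \in s -> (e <= dyn_dist d T n y z)%R.
  move=> zs; have /tnthP[i zE] : z \in Tuple (introT eqP sN) by [].
  by rewrite leNgt zE; apply/negP; exact: far.
have ys : y \notin s.
  apply/negP => /far; rewrite leNgt => /negP; apply.
  by apply/dyn_dist_lt => // t _; rewrite dxx.
have : P N.+1.
  apply/asboolP; exists (y :: s); split; rewrite /= ?ys ?sN//.
  move=> u v /=; rewrite !inE => /predU1P[->|us'] /predU1P[->|vs'] uv //.
  - exact: far.
  - by rewrite dyn_sym; exact: far.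
  - exact: ss.
by move=> /Nmax; rewrite ltnn.
Qed.

(** The limsup is nonincreasing in [e], so its limit at 0 is its supremum, and a supremum of
    nonnegative terms vanishes exactly when all of them do. *)
Lemma upper_Lambda_eq0 (s : R -> R) :
  (\forall n \near \oo, (0 <= s (expR (- n%:R)))%R) ->
  upper_Lambda d T s = 0 <->
  forall e eta : R, (0 < e)%R -> (0 < eta)%R -> \forall n \near \oo,
    sep_number d T n e * (s (expR (- n%:R)))%:E <= eta%:E.
Proof.
move=> s0; pose u e n := sep_number d T n e * (s (expR (- n%:R)))%:E.
pose G e := limn_esup (u e).
have G0 e : 0 <= G e.
  apply: limn_esup_ge0; apply: filterS s0 => n sn.
  by rewrite mule_ge0// sep_number_ge0.
have Gle e1 e2 : (e1 <= e2)%R -> G e2 <= G e1.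
  move=> e12; apply: le_limn_esup; apply: filterS s0 => n sn.
  by apply: lee_wpmul2r => //; exact: le_sep_number.
have -> : upper_Lambda d T s = ereal_sup (G @` [set` `]0%R, +oo[]).
  apply/cvg_lim => //; apply: nonincreasing_at_right_cvge => //.
  by move=> e1 e2 _ _; exact: Gle.
split=> [sup0 e eta e0 eta0|H].
  have Ge : G e < eta%:E.
    rewrite (@le_lt_trans _ _ 0)// -sup0; apply: ereal_sup_ubound.
    by exists e => //=; rewrite in_itv/= e0.
  by apply: filterS (limn_esup_lt Ge) => n; exact: ltW.
apply/eqP; rewrite eq_le; apply/andP; split; last first.
  apply: (le_trans (G0 1%R)); apply: ereal_sup_ubound.
  by exists 1%R => //=; rewrite in_itv/= ltr01.
apply: ge_ereal_sup => _ [e /= + <-]; rewrite in_itv/= andbT => e0.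
apply/lee_addgt0Pr => eta eta0; rewrite add0e.
by apply: limn_esup_le; exact: H.
Qed.

End sep_number.

Lemma near_expRN (R : realType) (P : R -> Prop) :
  (\forall e \near 0^'+, P e) -> \forall n \near \oo, P (expR (- n%:R)).
Proof.
move=> /nbhs_ballP[r /= r0 rP]; near=> n; apply: rP; last exact: expR_gt0.
rewrite /ball/= sub0r normrN gtr0_norm ?expR_gt0// expRN.
rewrite (@le_lt_trans _ _ (n.+1%:R^-1))//.
  by rewrite lef_pV2 ?posrE ?expR_gt0// -nat1r expR_ge1Dx.
by near: n; exact: near_infty_natSinv_lt (PosNum r0).
Unshelve. all: by end_near. Qed.

(** * Zero entropy as a bound on growth *)

Section scaling.
Context (R : realType) (scl : R -> R -> R).
Hypotheses (scl_scaling : scaling scl) (scl_vanishing : vanishing_scaling scl).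

(** [n = 0] is left out because [expR 0] is 1, outside the open interval on which [scaling] gives
    positivity. *)
Lemma scl_expRN a n : 0 < a -> (0 < n)%N ->
  scl a (expR (- n%:R)) = expR (- log_scl scl a n).
Proof.
move=> a0 n0; rewrite /log_scl opprK lnK// posrE.
apply: (scaling_gt0 scl_scaling); first exact: ltW.
by rewrite expR_gt0 expR_lt1 oppr_lt0 ltr0n.
Qed.

(** Eventually [scl b] is at most 1, so its power with exponent [l > 1] is at most [scl b]
    itself. *)
Lemma scl_littleo a b (eta : R) : 0 < b < a -> 0 < eta ->
  \forall n \near \oo, scl a (expR (- n%:R)) <= eta * scl b (expR (- n%:R)).
Proof.
move=> ba eta0; have /andP[b0 _] := ba.
have a0 : 0 < a by case/andP: ba; exact: lt_trans.
have /filter_ex[l [l1 /eqoP/(_ _ eta0) small]] : \forall l \near (1 : R)^'+, 1 < l /\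
    (fun e : R => scl a e) =o_ (0^'+) (fun e : R => scl b e `^ l).
  apply: filterI; first exact: nbhs_right_gt.
  exact: scaling_o_val scl_scaling _ _ ba.
have scl_b1 : \forall e \near (0 : R)^'+, scl b e <= 1.
  exact: cvgr_le (scl_vanishing b0) _ ltr01.
have := near_expRN small; have := near_expRN scl_b1.
move=> near1 near2; near=> n.
have n0 : (0 < n)%N by near: n; exact: nbhs_infty_gt.
have sb1 : scl b (expR (- n%:R)) <= 1 by near: n.
have sb0 : 0 < scl b (expR (- n%:R)) by rewrite scl_expRN ?expR_gt0.
have : `|scl a (expR (- n%:R))| <= eta * `|scl b (expR (- n%:R)) `^ l| by near: n.
rewrite !ger0_norm ?powR_ge0 ?(scl_expRN a0 n0) ?expR_ge0// => /le_trans; apply.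
by rewrite ler_pM2l// -[leRHS](powRr1 (ltW sb0)) ger_powR ?sb0// ltW.
Unshelve. all: by end_near. Qed.

Lemma log_scl_ge (a C : R) : 0 < a -> \forall n \near \oo, C <= log_scl scl a n.
Proof.
move=> a0.
have /near_expRN near1 : \forall e \near (0 : R)^'+, scl a e <= expR (- C).
  exact: cvgr_le (scl_vanishing a0) _ (expR_gt0 (- C)).
near=> n.
have n0 : (0 < n)%N by near: n; exact: nbhs_infty_gt.
have : scl a (expR (- n%:R)) <= expR (- C) by near: n.
by rewrite scl_expRN// ler_expR lerN2.
Unshelve. all: by end_near. Qed.

Section entropy.
Context (X : choiceType) (d : X -> X -> R) (T : X -> X).

Lemma upper_capacity_entropy_ge0 : (0 <= upper_capacity_entropy d T scl)%E.
Proof.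
by apply: le_ereal_inf_tmp => _ [a [a0 _] <-]; rewrite lee_fin ltW.
Qed.

Lemma upper_capacity_entropy_gt0 :
  (0 < upper_capacity_entropy d T scl)%E <-> upper_capacity_entropy d T scl <> 0%E.
Proof. by rewrite lt_def upper_capacity_entropy_ge0 andbT; split=> /eqP. Qed.

(** Passing to a smaller index absorbs constants, so the limits and the infimum over indices reduce
    to one eventual bound for each [a] and [e], in a form that can be compared between two
    systems. *)
Lemma upper_capacity_entropy_eq0 :
  upper_capacity_entropy d T scl = 0%E <->
  forall a e : R, 0 < a -> 0 < e -> \forall n \near \oo,
    (sep_number d T n e <= (expR (log_scl scl a n))%:E)%E.
Proof.
have scl_ge0 a : 0 < a -> \forall n \near \oo, 0 <= scl a (expR (- n%:R)).
  by move=> a0; near=> n; rewrite scl_expRN ?expR_ge0//; near: n; exact: nbhs_infty_gt.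
split=> [h0 a e a0 e0|H].
  have : (upper_capacity_entropy d T scl < a%:E)%E by rewrite h0 lte_fin.
  move=> /ereal_inf_lt[_ [b [b0 Lb] <-]]; rewrite lte_fin => ba.
  have nearb := proj1 (upper_Lambda_eq0 _ _ (scl_ge0 b b0)) Lb e 1 e0 ltr01.
  have nearab : \forall n \near \oo, scl a (expR (- n%:R)) <= 1 * scl b (expR (- n%:R)).
    by apply: scl_littleo => //; rewrite b0.
  near=> n; have n0 : (0 < n)%N by near: n; exact: nbhs_infty_gt.
  have : scl a (expR (- n%:R)) <= 1 * scl b (expR (- n%:R)) by near: n.
  rewrite mul1r !scl_expRN// ler_expR lerN2 => ab.
  apply: (@le_trans _ _ (expR (log_scl scl b n))%:E); last by rewrite lee_fin ler_expR.
  have : (sep_number d T n e * (scl b (expR (- n%:R)))%:E <= 1%:E)%E by near: n.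
  by rewrite scl_expRN// expRN lee_pdivrMr ?expR_gt0// mul1e.
apply/eqP; rewrite eq_le upper_capacity_entropy_ge0 andbT.
apply/lee_addgt0Pr => a a0; rewrite add0e.
apply: ereal_inf_lbound; exists a => //; split => //.
apply/(upper_Lambda_eq0 _ _ (scl_ge0 a a0)) => e eta e0 eta0.
have a2 : 0 < a / 2 < a by apply/andP; split; lra.
have [a20 _] := andP a2.
have nearab := scl_littleo a2 eta0; have nears := H _ _ a20 e0.
near=> n; have n0 : (0 < n)%N by near: n; exact: nbhs_infty_gt.
apply: (@le_trans _ _ ((expR (log_scl scl (a / 2) n))%:E * (scl a (expR (- n%:R)))%:E)%E).
  apply: lee_wpmul2r; last by near: n.
  by rewrite lee_fin scl_expRN ?expR_ge0.
rewrite -EFinM lee_fin -ler_pdivlMl ?expR_gt0// mulrC -expRN -scl_expRN//.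
by near: n.
Unshelve. all: by end_near. Qed.

End entropy.
End scaling.

(** * Comparison of the growth rates *)

Section comparison.
Context (R : realType) (X : pmetricType R).
Hypothesis compactX : compact [set: X].
Variable T : continuousType X X.
Context (dM : borel_prob X -> borel_prob X -> R) (dM_compat : weak_star_metric dM).
Local Notation sepX := (sep_number (@mdist R X) T).
Local Notation sepM := (sep_number dM (push_prob T)).

(** When the integrals agree, the constant family [nu] tends to [mu] for [dM], so the distance is
    below every positive number. *)
Lemma mean_inj mu nu :
  (forall f : X -> R, continuous f -> mean mu f = mean nu f) -> mu = nu.
Proof.
move=> munu; have [[dxx deq _ _] _] := dM_compat.
have close (e : R) : 0 < e -> \forall i \near (0 : R)^'+, dM mu nu < e.
  apply: (weak_star_cvg_dist dM_compat (mu_ := fun=> nu)) => f cf.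
  by rewrite munu//; exact: cvg_cst.
apply: deq; apply/eqP; rewrite eq_le; apply/andP; split.
  by apply/ler_addgt0Pl => r /close/filter_ex[_ /ltW]; rewrite addr0.
rewrite leNgt; apply/negP => d_lt0.
have [_ _ dsym dtri] := proj1 dM_compat.
by have := dtri mu nu mu; rewrite dxx (dsym nu); lra.
Qed.

Lemma iter_push_dirac j (x : X) :
  iter j (push_prob T) (dirac_prob x) = dirac_prob (iter j T x).
Proof.
apply: mean_inj => f cf; rewrite mean_iter_push// !mean_dirac//.
move=> y; apply: continuous_comp; [exact: continuous_iter | exact: cf].
Qed.

(** [dirac_prob] intertwines [T] and [push_prob T], and its inverse on the image is uniformly
    continuous, so it carries separated sets to separated sets. *)
Lemma sep_number_dirac (e : R) : 0 < e -> exists2 r : R, 0 < r &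
  forall n (x : R), (sepM n r <= x%:E)%E -> (sepX n e <= x%:E)%E.
Proof.
move=> e0; have [r r0 rP] := dirac_prob_separates compactX dM_compat e0.
exists r => // n x sMx; apply: sep_number_le => s us ss.
have far y z : y \in s -> z \in s -> y <> z ->
    r <= dyn_dist dM (push_prob T) n (dirac_prob y) (dirac_prob z).
  move=> ys zs yz; rewrite leNgt; apply/negP => /(dyn_dist_lt _ _ _ _ _ r0) close.
  have := ss y z ys zs yz; rewrite leNgt => /negP; apply.
  apply/(dyn_dist_lt _ _ _ _ _ e0) => t tn; apply: rP.
  by rewrite -!iter_push_dirac; exact: close.
have inj : {in s &, injective (@dirac_prob R X)}.
  move=> y z ys zs yz; apply: contrapT => /(far y z ys zs).
  rewrite yz leNgt => /negP; apply; apply/(dyn_dist_lt _ _ _ _ _ r0) => t _.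
  by have [[-> _ _ _] _] := dM_compat.
rewrite -lee_fin -(size_map (@dirac_prob R X)); apply: le_trans sMx.
apply: size_le_sep_number; first by rewrite map_inj_in_uniq.
move=> mu nu /= /mapP[y ys ->] /mapP[z zs ->] yz; apply: far => // yz'.
by rewrite yz' in yz.
Qed.

(** A maximal separated set of [X] serves as the spanning set. [k] and [tau] stay free, because the
    two growth regimes choose them differently. *)
Lemma sep_number_measures_le (e : R) : 0 < e ->
  exists (d q : R) (m K : nat), [/\ 0 < d, 0 < q < 1 &
  forall n k (tau y : R), 0 <= tau -> (sepX n d <= (expR y)%:E)%E ->
    (sepM n e <= (expR (k%:R * y + (tau * (n%:R * m%:R * 2 * q ^+ k) +
      n%:R * K%:R * expR (- tau))))%:E)%E].
Proof.
move=> e0; have [d [q [m [K [d0 q01 bound]]]]] :=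
  separated_measures_bound compactX T dM_compat e0.
exists d, q, m, K; split => // n k tau y tau0 sy.
have [N [E [Ny span]]] :=
  exists_spanning d0 (@mdistxx R X) (@metric_sym R X) sy.
apply: sep_number_le => s us ss; rewrite expRD.
apply: (le_trans (bound n k N tau E tau0 span s us ss)).
rewrite ler_wpM2r ?expR_ge0// expRM_natl.
by rewrite lerXn2r ?nnegrE ?expR_ge0.
Qed.

(** The quadratic bound at 1/2 gives [expR 2^-1 <= 2]. *)
Lemma half_le_ln2 : 2^-1 <= ln 2 :> R.
Proof.
rewrite -ler_expR lnK ?posrE//; apply: le_trans (expR_le_quadratic _) _ => //.
lra.
Qed.

(* With about [c * ln n.+1] sample points and [tau = ln n.+1], the exceptional
   times only contribute a bounded factor. *)
Lemma measures_growth_log (a b : nat -> R) (e : R) : 0 < e ->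
  (forall C : R, \forall n \near \oo, C <= a n) ->
  (\forall n \near \oo, 0 <= b n) ->
  b n * ln n.+1%:R / a n @[n --> \oo] --> (0 : R) ->
  (forall d : R, 0 < d -> \forall n \near \oo, (sepX n d <= (expR (b n))%:E)%E) ->
  \forall n \near \oo, (sepM n e <= (expR (a n))%:E)%E.
Proof.
move=> e0 a_ge b_ge0 ba0 sX.
have [d [q [m [K [d0 /andP[q0 q1] bound]]]]] := sep_number_measures_le e0.
have lnq : ln q < 0 by rewrite ln_lt0// q0.
(* Chosen so that [q] to the power [c * L], with [L = ln n.+1%:R], is the inverse square of
   [n.+1]. *)
pose c := - 2 / ln q.
have c0 : 0 < c by rewrite /c mulNr -mulrN -invrN divr_gt0// oppr_gt0.
(* [C1 * L] bounds [k]: rounding up costs at most 1, hence at most [2 * L]. [C2] bounds the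
   contribution of the exceptional times. Each of the two costs stays within half of [a n]. *)
pose C1 := c + 2; pose C2 : R := 2 * m%:R + K%:R.
have C10 : 0 < C1 by rewrite addr_gt0.
have C20 : 0 <= C2 by rewrite addr_ge0// mulr_ge0.
have small : \forall n \near \oo, b n * ln n.+1%:R / a n <= (2 * C1)^-1.
  by apply: cvgr_le ba0 _ _; rewrite invr_gt0 mulr_gt0.
have sXd := sX d d0; have a_large := a_ge (2 * C2 + 1).
near=> n.
have n1 : (1 : R) <= n%:R by rewrite ler1n; near: n; exact: nbhs_infty_gt.
have bn0 : 0 <= b n by near: n.
have an : 2 * C2 + 1 <= a n by near: n.
have an0 : 0 < a n by lra.
have bLa : b n * ln n.+1%:R / a n <= (2 * C1)^-1 by near: n.
pose L : R := ln n.+1%:R.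
have nS0 : 0 < n.+1%:R :> R by rewrite ltr0n.
have L2 : 2^-1 <= L.
  by apply: (le_trans half_le_ln2); rewrite ler_ln ?posrE// -natr1; lra.
have Ln : L <= n%:R.
  by rewrite /L -natr1 addrC; apply: le_ln1Dx; lra.
pose k := (Num.truncn (c * L)).+1.
have cL0 : 0 <= c * L by rewrite mulr_ge0 ?ltW//; lra.
have kL : c * L <= k%:R by rewrite ltW// truncnS_gt.
have kC : k%:R <= C1 * L.
  by have /andP[+ _] := truncn_itv cL0; rewrite /k -natr1 /C1 mulrDl; lra.
have L0 : 0 <= L by lra.
have eL : expR (- L) = n.+1%:R^-1 by rewrite expRN lnK.
rewrite -/L in bLa; clearbody k L.
have sXn : (sepX n d <= (expR (b n))%:E)%E by near: n.
apply: (le_trans (bound n k L (b n) L0 sXn)); rewrite lee_fin ler_expR.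
have qk : q ^+ k <= n.+1%:R^-1 ^+ 2.
  rewrite -eL -expRM_natl -{1}(lnK (x := q)) ?posrE// -expRM_natl ler_expR.
  have -> : 2%:R * - L = c * L * ln q by rewrite /c; field; rewrite lt_eqF.
  by rewrite ler_wnM2r// ltW.
have part1 : L * (n%:R * m%:R * 2 * q ^+ k) <= 2 * m%:R.
  have n2 : n%:R * n%:R * q ^+ k <= 1.
    apply: (@le_trans _ _ (n%:R * n%:R * n.+1%:R^-1 ^+ 2)).
      by rewrite ler_wpM2l// mulr_ge0.
    rewrite exprVn ler_pdivrMr ?exprn_gt0// mul1r expr2.
    by rewrite ler_pM// ler_nat.
  have -> : L * (n%:R * m%:R * 2 * q ^+ k) = (2 * m%:R) * (L * n%:R * q ^+ k) by ring.
  rewrite ler_piMr ?mulr_ge0//; apply: le_trans n2.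
  by apply: ler_wpM2r; [rewrite exprn_ge0// ltW | exact: ler_wpM2r].
have part2 : n%:R * K%:R * expR (- L) <= K%:R.
  rewrite eL ler_pdivrMr// mulrC ler_wpM2l//.
  by rewrite ler_nat.
have part3 : k%:R * b n <= a n / 2.
  apply: (@le_trans _ _ (C1 * (b n * L))).
    by rewrite (mulrC (b n)) mulrA; exact: ler_wpM2r.
  have -> : a n / 2 = C1 * ((2 * C1)^-1 * a n) by field; rewrite gt_eqF.
  by rewrite ler_pM2l// -ler_pdivrMr.
rewrite /C2 in an; lra.
Unshelve. all: by end_near. Qed.

(* With a fixed number of sample points, the exceptional times contribute an
   exponential factor of arbitrarily small rate. *)
Lemma measures_growth_linear (a : nat -> R) (c e : R) : 0 < e -> 0 < c ->
  (\forall n \near \oo, c * n%:R <= a n) ->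
  (forall w d : R, 0 < w -> 0 < d ->
    \forall n \near \oo, (sepX n d <= (expR (w * n%:R))%:E)%E) ->
  \forall n \near \oo, (sepM n e <= (expR (a n))%:E)%E.
Proof.
move=> e0 c0 a_ge sX.
have [d [q [m [K [d0 /andP[q0 q1] bound]]]]] := sep_number_measures_le e0.
(* The three terms of the exponent get a third of the rate [c] each: [tau] is fixed first, then [k]
   depending on [tau], then the growth rate allowed for [X] depending on [k]. *)
have c3 : 0 < c / 3 by rewrite divr_gt0.
have [tau [tau0 Ktau]] : exists tau : R, 0 <= tau /\ K%:R * expR (- tau) <= c / 3.
  exists (K%:R / (c / 3)); split; first by rewrite divr_ge0// ltW.
  rewrite expRN ler_pdivrMr ?expR_gt0// mulrC -ler_pdivrMr//.
  by apply: le_trans (expR_ge1Dx _); lra.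
have [k [k0 qk]] : exists k, (0 < k)%N /\ tau * (m%:R * 2 * q ^+ k) <= c / 3.
  have : tau * (m%:R * 2) * q ^+ k @[k --> \oo] --> tau * (m%:R * 2) * 0.
    by apply: cvgMl_tmp; apply: cvg_expr; rewrite gtr0_norm.
  rewrite mulr0 => /cvgr_le/(_ _ c3) near_k.
  have /filter_ex[k [k0 kP]] : \forall k \near \oo, (0 < k)%N /\
      tau * (m%:R * 2) * q ^+ k <= c / 3.
    by apply: filterI => //; exact: nbhs_infty_gt.
  by exists k; split => //; rewrite mulrA.
have kR0 : 0 < k%:R :> R by rewrite ltr0n.
have w0 : 0 < c / 3 / k%:R by rewrite divr_gt0.
have sXd := sX _ _ w0 d0.
near=> n.
have sXn : (sepX n d <= (expR (c / 3 / k%:R * n%:R))%:E)%E by near: n.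
apply: (le_trans (bound n k tau _ tau0 sXn)); rewrite lee_fin ler_expR.
have an : c * n%:R <= a n by near: n.
apply: le_trans an.
have -> : k%:R * (c / 3 / k%:R * n%:R) + (tau * (n%:R * m%:R * 2 * q ^+ k) +
    n%:R * K%:R * expR (- tau)) = n%:R * (c / 3 + tau * (m%:R * 2 * q ^+ k) +
    K%:R * expR (- tau)) by field; rewrite gt_eqF.
rewrite mulrC ler_wpM2r//; lra.
Unshelve. all: by end_near. Qed.

End comparison.

(** * Equivalence of zero entropy for the two systems *)

Lemma limn_einf_gt0 (R : realType) (u : nat -> \bar R) :
  (0 < limn_einf u)%E -> exists2 c : R, 0 < c & \forall n \near \oo, (c%:E <= u n)%E.
Proof.
rewrite oppe_gt0 => sup_lt0.
have [c c0 supc] : exists2 c : R, 0 < c & (limn_esup (\- u) < (- c)%:E)%E.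
  move: sup_lt0; case: (limn_esup _) => [r| |] //.
    rewrite lte_fin => r0; exists (- r / 2); first lra.
    by rewrite lte_fin; lra.
  by move=> _; exists 1 => //; rewrite ltNyr.
exists c => //; apply: filterS (limn_esup_lt supc) => n.
by rewrite EFinN lteN2 => /ltW.
Qed.

Theorem theorem1p3 (R : realType) (X : pmetricType R)
  (compactX : compact [set: X]) (T : continuousType X X)
  (dM : borel_prob X -> borel_prob X -> R) (dM_compat : weak_star_metric dM)
  (scl : R -> R -> R) (scl_scaling : scaling scl)
  (scl_vanishing : vanishing_scaling scl)
  (hB : B_log scl = set0 \/
    [/\ B_log scl !=set0,
        ereal_inf [set limn_esup (fun n => (log_scl scl g n / n%:R)%:E)
                  | g in [set g : R | 0 < g]] = 0%E &
        forall a : R, B_log scl a ->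
          (0%E < limn_einf (fun n => (log_scl scl a n / n%:R)%:E))%E]) :
  (upper_capacity_entropy (@mdist R X) T scl = 0%E <->
   upper_capacity_entropy dM (push_prob T) scl = 0%E) /\
  ((0 < upper_capacity_entropy (@mdist R X) T scl)%E <->
   (0 < upper_capacity_entropy dM (push_prob T) scl)%E).
Proof.
have zero : upper_capacity_entropy (@mdist R X) T scl = 0%E <->
    upper_capacity_entropy dM (push_prob T) scl = 0%E.
  split=> /(upper_capacity_entropy_eq0 scl_scaling scl_vanishing) H;
      apply/(upper_capacity_entropy_eq0 scl_scaling scl_vanishing) => a e a0 e0.
    have a_ge C := log_scl_ge scl_scaling scl_vanishing C a0.
    have [aB|naB] := pselect (B_log scl a).
      case: hB => [B0|[_ inf0 liminf]]; first by move: aB; rewrite B0.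
      have [c c0 ac] := limn_einf_gt0 (liminf a aB).
      apply: (measures_growth_linear compactX dM_compat e0 c0).
        near=> n; have n0 : 0 < n%:R :> R.
          by rewrite ltr0n; near: n; exact: nbhs_infty_gt.
        rewrite -ler_pdivlMr// -lee_fin; near: n.
        exact: ac.
      (* Zero topological entropy of [X]: since the infimum is zero, some [log_scl scl g] grows at a
         rate below [w], and the growth bound at index [g] applies. *)
      move=> w d w0 d0.
      have : (0%E < w%:E)%E by rewrite lte_fin.
      rewrite -inf0.
      move=> /ereal_inf_lt[_ [g /= g0 <-] /limn_esup_lt gw].
      have Hg := H g d g0 d0.
      near=> n; have n0 : 0 < n%:R :> R.
        by rewrite ltr0n; near: n; exact: nbhs_infty_gt.
      apply: (@le_trans _ _ (expR (log_scl scl g n))%:E); first by near: n.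
      rewrite lee_fin ler_expR -ler_pdivrMr// -lee_fin; apply: ltW.
      by near: n.
    have [b [ba ba0]] : exists b : R, 0 < b < a /\
        log_scl scl b n * ln n.+1%:R / log_scl scl a n @[n --> \oo] --> (0 : R).
      by apply: contrapT => nb; apply: naB.
    have b0 : 0 < b by case/andP: ba.
    have b_ge0 := log_scl_ge scl_scaling scl_vanishing 0 b0.
    apply: (measures_growth_log compactX dM_compat e0 a_ge b_ge0 ba0) => d d0.
    exact: H.
  have [r r0 rP] := sep_number_dirac compactX T dM_compat e0.
  have Hr := H a r a0 r0.
  by apply: filterS Hr => n; exact: rP.
have gt0X := upper_capacity_entropy_gt0 scl (@mdist R X) T.
have gt0M := upper_capacity_entropy_gt0 scl dM (push_prob T).
split; first exact: zero.
exact: iff_trans gt0X (iff_trans (not_iff_compat zero) (iff_sym gt0M)).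
Unshelve. all: by end_near. Qed.
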